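(* The lax Gray product $(X,Y)\mapsto X\boxtimes Y$ (defined in the context) defines a monoidal structure on $\mathbf{MrgBiCat}$, whose unit is the merge-bicategory $1$ with a single 0-cell and no 1-cells or 2-cells.
   Context: A regular 2-polygraph $X$ consists of a set of 0-cells, a set of 1-cells $a: x \to y$ (each with a source and a target 0-cell), and, for all $n,m\ge 1$, a set of 2-cells $p:(a_1,\ldots,a_n)\to(b_1,\ldots,b_m)$, whose input and output are non-empty composable sequences of 1-cells with the same initial source and the same final target. Greek capitals denote possibly empty composable sequences of 1-cells, and commas denote concatenation. A merge-bicategory is a regular 2-polygraph with operations: given $t:(\Gamma)\to(\Delta_1,\Lambda,\Delta_2)$ and $s:(\Gamma_1,\Lambda,\Gamma_2)\to(\Delta)$ with $\Lambda$ non-empty, occupying outputs $j_1,\ldots,j_2$ of $t$ and inputs $i_1,\ldots,i_2$ of $s$, such that ($\Gamma_1$ or $\Delta_1$ is empty) and ($\Gamma_2$ or $\Delta_2$ is empty), a 2-cell $\mathrm{mrg}_{[j_1,j_2]}^{[i_1,i_2]}(t,s):(\Gamma_1,\Gamma,\Gamma_2)\to(\Delta_1,\Delta,\Delta_2)$. These satisfy associativity and interchange equations: whenever the same pasting diagram of three 2-cells (with the same identifications of output 1-cells with input 1-cells) can be evaluated by two successive merges in two different orders, the two results are equal. No units are part of the structure. Morphisms preserve boundaries and merges; merge-bicategories and morphisms form the category $\mathbf{MrgBiCat}$. Lax Gray product. Given merge-bicategories $X$, $Y$, the merge-bicategory $X\boxtimes Y$ is defined as follows. - 0-cells: $x\boxtimes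 y$, for 0-cells $x$ of $X$ and $y$ of $Y$. - 1-cells: $x\boxtimes b: x\boxtimes y\to x\boxtimes y'$ for each 0-cell $x$ of $X$ and 1-cell $b:y\to y'$ of $Y$, and $a\boxtimes y: x\boxtimes y\to x'\boxtimes y$ for each 1-cell $a:x\to x'$ of $X$ and 0-cell $y$ of $Y$. - 2-cells: generated under the merge operations by (i) $x\boxtimes p':(x\boxtimes a'_1,\ldots,x\boxtimes a'_n)\to(x\boxtimes b'_1,\ldots,x\boxtimes b'_m)$ for each 0-cell $x$ of $X$ and 2-cell $p':(a'_1,\ldots,a'_n)\to(b'_1,\ldots,b'_m)$ of $Y$; (ii) $p\boxtimes y:(a_1\boxtimes y,\ldots,a_n\boxtimes y)\to(b_1\boxtimes y,\ldots,b_m\boxtimes y)$ for each 2-cell $p:(a_1,\ldots,a_n)\to(b_1,\ldots,b_m)$ of $X$ and 0-cell $y$ of $Y$; (iii) squares $a\boxtimes b:(x\boxtimes b,\ a\boxtimes y')\to(a\boxtimes y,\ x'\boxtimes b)$ for all 1-cells $a:x\to x'$ of $X$ and $b:y\to y'$ of $Y$; subject to the equations: (1) $x\boxtimes\mathrm{mrg}_{[j_1,j_2]}^{[i_1,i_2]}(p',q')=\mathrm{mrg}_{[j_1,j_2]}^{[i_1,i_2]}(x\boxtimes p',x\boxtimes q')$ and $\mathrm{mrg}_{[j_1,j_2]}^{[i_1,i_2]}(p,q)\boxtimes y=\mathrm{mrg}_{[j_1,j_2]}^{[i_1,i_2]}(p\boxtimes y,q\boxtimes y)$ whenever the left-hand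 sides are defined; (2) for each 1-cell $c:x\to x'$ of $X$ and 2-cell $p':(a'_1,\ldots,a'_n)\to(b'_1,\ldots,b'_m)$ of $Y$ with initial 0-cell $y^-$ and final 0-cell $y^+$, the two composites $(x\boxtimes a'_1,\ldots,x\boxtimes a'_n,c\boxtimes y^+)\to(c\boxtimes y^-,x'\boxtimes b'_1,\ldots,x'\boxtimes b'_m)$ given by $x\boxtimes p'$ followed by the squares $c\boxtimes b'_m,\ldots,c\boxtimes b'_1$, and by the squares $c\boxtimes a'_n,\ldots,c\boxtimes a'_1$ followed by $x'\boxtimes p'$, are equal; (3) for each 1-cell $c':y\to y'$ of $Y$ and 2-cell $p:(a_1,\ldots,a_n)\to(b_1,\ldots,b_m)$ of $X$ with initial 0-cell $x^-$ and final 0-cell $x^+$, the two composites $(x^-\boxtimes c',a_1\boxtimes y',\ldots,a_n\boxtimes y')\to(b_1\boxtimes y,\ldots,b_m\boxtimes y,x^+\boxtimes c')$ given by $p\boxtimes y'$ followed by the squares $b_1\boxtimes c',\ldots,b_m\boxtimes c'$, and by the squares $a_1\boxtimes c',\ldots,a_n\boxtimes c'$ followed by $p\boxtimes y$, are equal. For morphisms $f:X\to X'$, $g:Y\to Y'$, the morphism $f\boxtimes g$ is defined on generators by $(f\boxtimes g)(u\boxtimes v)=f(u)\boxtimes g(v)$ and extended freely. *)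

(* Defs.v *)
From mathcomp Require Import ssreflect ssrfun ssrbool seq.
From mathcomp Require Import boolp.

Set Implicit Arguments.
Unset Strict Implicit.
Unset Printing Implicit Defensive.

Fixpoint chain (C0 C1 : Type) (s t : C1 -> C0) (x : C0) (l : seq C1) (y : C0)
    : Prop :=
  if l is a :: l' then s a = x /\ chain s t (t a) l' y else x = y.

Record polygraph := Polygraph {
  cell0 : Type;
  cell1 : Type;
  cell2 : Type;
  src : cell1 -> cell0;
  tgt : cell1 -> cell0;
  inp : cell2 -> seq cell1;
  out : cell2 -> seq cell1;
  inp_neq0 : forall p, inp p <> [::];
  out_neq0 : forall p, out p <> [::];
  globular : forall p, exists x y,
    chain src tgt x (inp p) y /\ chain src tgt x (out p) y }.

Record polymor (X Y : polygraph) := PolyMor {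
  mor0 : cell0 X -> cell0 Y;
  mor1 : cell1 X -> cell1 Y;
  mor2 : cell2 X -> cell2 Y;
  mor_src : forall a, src (mor1 a) = mor0 (src a);
  mor_tgt : forall a, tgt (mor1 a) = mor0 (tgt a);
  mor_inp : forall p, inp (mor2 p) = map mor1 (inp p);
  mor_out : forall p, out (mor2 p) = map mor1 (out p) }.

(** The data "[t] has output [(D1, L, D2)] and [s] has input [(G1, L, G2)]".
    For given [t] and [s] it amounts to the index intervals [[j1,j2]] and
    [[i1,i2]] occupied by [L]. *)
Record overlap (A : Type) := Overlap {
  out_l : seq A;   (* Delta_1 *)
  shared : seq A;  (* Lambda *)
  out_r : seq A;   (* Delta_2 *)
  inp_l : seq A;   (* Gamma_1 *)
  inp_r : seq A }. (* Gamma_2 *)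

Definition map_overlap (A B : Type) (f : A -> B) (w : overlap A) : overlap B :=
  Overlap (map f (out_l w)) (map f (shared w)) (map f (out_r w))
          (map f (inp_l w)) (map f (inp_r w)).

Definition fits (A : Type) (w : overlap A) (o i : seq A) : Prop :=
  [/\ o = out_l w ++ shared w ++ out_r w,
      i = inp_l w ++ shared w ++ inp_r w,
      shared w <> [::],
      inp_l w = [::] \/ out_l w = [::] &
      inp_r w = [::] \/ out_r w = [::]].

(** A regular 2-polygraph with merge operations, not yet subject to any
    equation. *)
Record premerge := PreMerge {
  ppoly :> polygraph;
  mrg : forall (t s : cell2 ppoly) (w : overlap (cell1 ppoly)),
    fits w (out t) (inp s) -> cell2 ppoly;
  inp_mrg : forall t s w (h : fits w (out t) (inp s)),
    inp (mrg h) = inp_l w ++ inp t ++ inp_r w;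
  out_mrg : forall t s w (h : fits w (out t) (inp s)),
    out (mrg h) = out_l w ++ out s ++ out_r w }.

(** Pairs of evaluations, in two different orders, of the same pasting diagram
    of three 2-cells.  A double merge has the form [(t,s),r] or [t,(s,r)], and
    the merges force [t] before [s] before [r], or two of the cells to be side
    by side; so, up to exchanging the two sides, there are three cases.
    - [law_assoc]: [t] feeds [s] (along [L]) and [s] feeds [r] (along [M]);
      moreover [t] may feed [r] directly, to the left ([M1]) or to the right
      ([M2]) of [s].  If [M1] is non-empty, then [h1] makes [G1] empty and [h3]
      makes [S1] empty, so that the identifications of 1-cells do agree on the
      two sides; likewise on the right.
    - [law_out]: [t] feeds both [s] (along [L]) and [r] (along [M]).
    - [law_inp]: [t] (along [L]) and [s] (along [M]) both feed [r]. *)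
Inductive merge_law (X : premerge) : cell2 X -> cell2 X -> Prop :=
| law_assoc (t s r : cell2 X) (A M1 L M2 B G1 G2 S1 M S2 H1 H2 : seq (cell1 X))
    (h1 : fits (Overlap (A ++ M1) L (M2 ++ B) G1 G2) (out t) (inp s))
    (h2 : fits (Overlap (A ++ S1) (M1 ++ M ++ M2) (S2 ++ B) H1 H2)
               (out (mrg h1)) (inp r))
    (h3 : fits (Overlap S1 M S2 (H1 ++ M1) (M2 ++ H2)) (out s) (inp r))
    (h4 : fits (Overlap A (M1 ++ L ++ M2) B (H1 ++ G1) (G2 ++ H2))
               (out t) (inp (mrg h3))) :
    merge_law (mrg h2) (mrg h4)
| law_out (t s r : cell2 X) (A L B M C G1 G2 H1 H2 : seq (cell1 X))
    (h1 : fits (Overlap A L (B ++ M ++ C) G1 G2) (out t) (inp s))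
    (h2 : fits (Overlap (A ++ out s ++ B) M C H1 H2) (out (mrg h1)) (inp r))
    (h3 : fits (Overlap (A ++ L ++ B) M C H1 H2) (out t) (inp r))
    (h4 : fits (Overlap A L (B ++ out r ++ C) G1 G2) (out (mrg h3)) (inp s)) :
    merge_law (mrg h2) (mrg h4)
| law_inp (t s r : cell2 X) (A L B M C D1 D2 E1 E2 : seq (cell1 X))
    (h1 : fits (Overlap E1 M E2 (A ++ L ++ B) C) (out s) (inp r))
    (h2 : fits (Overlap D1 L D2 A (B ++ inp s ++ C)) (out t) (inp (mrg h1)))
    (h3 : fits (Overlap D1 L D2 A (B ++ M ++ C)) (out t) (inp r))
    (h4 : fits (Overlap E1 M E2 (A ++ inp t ++ B) C) (out s) (inp (mrg h3))) :
    merge_law (mrg h2) (mrg h4).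

Record mergebicat := MergeBicat {
  mpre :> premerge;
  merge_eq : forall u v : cell2 mpre, merge_law u v -> u = v }.

Lemma fits_map (A B : Type) (f : A -> B) (w : overlap A) o i :
  fits w o i -> fits (map_overlap f w) (map f o) (map f i).
Proof.
case=> -> -> Hs Hl Hr; split; rewrite /= ?map_cat //.
- by case: (shared w) Hs.
- by case: Hl => ->; [left | right].
- by case: Hr => ->; [left | right].
Qed.

Lemma fits_mor (X Y : polygraph) (f : polymor X Y) (t s : cell2 X) w :
  fits w (out t) (inp s) ->
  fits (map_overlap (mor1 f) w) (out (mor2 f t)) (inp (mor2 f s)).
Proof. by rewrite mor_out mor_inp; apply: fits_map. Qed.

Record mergemor (X Y : premerge) := MergeMor {
  mpoly :> polymor X Y;
  mor_mrg : forall (t s : cell2 X) w (h : fits w (out t) (inp s)),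
    mor2 mpoly (mrg h) = mrg (fits_mor mpoly h) }.

Lemma mrg_ext (X : premerge) (t t' s s' : cell2 X) w w'
    (h : fits w (out t) (inp s)) (h' : fits w' (out t') (inp s')) :
  t = t' -> s = s' -> w = w' -> mrg h = mrg h'.
Proof.
move=> et es ew; subst t' s' w'.
by rewrite (Prop_irrelevance h h').
Qed.

Record category := Category {
  ob :> Type;
  hom : ob -> ob -> Type;
  idm : forall A, hom A A;
  comp : forall A B C, hom B C -> hom A B -> hom A C;
  comp_idl : forall A B (f : hom A B), comp (idm B) f = f;
  comp_idr : forall A B (f : hom A B), comp f (idm A) = f;
  comp_assoc : forall A B C D (h : hom C D) (g : hom B C) (f : hom A B),
    comp h (comp g f) = comp (comp h g) f }.

Arguments idm {c} A.
Arguments hom {c} A B.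

Definition is_iso (C : category) (A B : C) (f : hom A B) : Prop :=
  exists g : hom B A, comp g f = idm A /\ comp f g = idm B.

Record monoidal_structure (C : category) (ten : C -> C -> C)
    (tenm : forall {A A' B B' : C},
      hom A A' -> hom B B' -> hom (ten A B) (ten A' B'))
    (I : C) := MonoidalStructure {
  tenm_id : forall A B, tenm (idm A) (idm B) = idm (ten A B);
  tenm_comp : forall A A' A'' B B' B'' (f' : hom A' A'') (f : hom A A')
      (g' : hom B' B'') (g : hom B B'),
    tenm (comp f' f) (comp g' g) = comp (tenm f' g') (tenm f g);
  associator : forall A B D, hom (ten (ten A B) D) (ten A (ten B D));
  lunitor : forall A, hom (ten I A) A;
  runitor : forall A, hom (ten A I) A;
  associator_iso : forall A B D, is_iso (associator A B D);
  lunitor_iso : forall A, is_iso (lunitor A);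
  runitor_iso : forall A, is_iso (runitor A);
  associator_nat : forall A A' B B' D D'
      (f : hom A A') (g : hom B B') (h : hom D D'),
    comp (associator A' B' D') (tenm (tenm f g) h) =
    comp (tenm f (tenm g h)) (associator A B D);
  lunitor_nat : forall A A' (f : hom A A'),
    comp (lunitor A') (tenm (idm I) f) = comp f (lunitor A);
  runitor_nat : forall A A' (f : hom A A'),
    comp (runitor A') (tenm f (idm I)) = comp f (runitor A);
  triangle : forall A B,
    comp (tenm (idm A) (lunitor B)) (associator A I B) =
    tenm (runitor A) (idm B);
  pentagon : forall A B D E,
    comp (associator A B (ten D E)) (associator (ten A B) D E) =
    comp (tenm (idm A) (associator B D E))
      (comp (associator A (ten B D) E) (tenm (associator A B D) (idm E))) }.

Lemma polymor_ext (X Y : polygraph) (f g : polymor X Y) :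
  mor0 f =1 mor0 g -> mor1 f =1 mor1 g -> mor2 f =1 mor2 g -> f = g.
Proof.
case: f g => [f0 f1 f2 a b c d] [g0 g1 g2 a' b' c' d'] /=.
move=> /funext e0 /funext e1 /funext e2; subst g0 g1 g2.
by congr PolyMor; apply: Prop_irrelevance.
Qed.

Lemma mergemor_ext (X Y : premerge) (f g : mergemor X Y) :
  mor0 f =1 mor0 g -> mor1 f =1 mor1 g -> mor2 f =1 mor2 g -> f = g.
Proof.
case: f g => [f a] [g b] /= e0 e1 e2.
have e := polymor_ext e0 e1 e2; subst g.
by congr MergeMor; apply: Prop_irrelevance.
Qed.

Definition polymor_id (X : polygraph) : polymor X X.
Proof.
by exists id id id => *; rewrite ?map_id.
Defined.

Definition polymor_comp (X Y Z : polygraph) (g : polymor Y Z) (f : polymor X Y) :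
  polymor X Z.
Proof.
exists (mor0 g \o mor0 f) (mor1 g \o mor1 f) (mor2 g \o mor2 f) => p /=.
- by rewrite !mor_src.
- by rewrite !mor_tgt.
- by rewrite !mor_inp map_comp.
- by rewrite !mor_out map_comp.
Defined.

Lemma map_overlap_id (A : Type) (w : overlap A) : map_overlap id w = w.
Proof. by case: w => *; rewrite /map_overlap /= !map_id. Qed.

Lemma map_overlap_comp (A B C : Type) (g : B -> C) (f : A -> B) (w : overlap A) :
  map_overlap (g \o f) w = map_overlap g (map_overlap f w).
Proof. by case: w => *; congr Overlap; apply: map_comp. Qed.

Lemma mergemor_id_mrg (X : premerge) (t s : cell2 X) w
    (h : fits w (out t) (inp s)) :
  mor2 (polymor_id X) (mrg h) = mrg (fits_mor (polymor_id X) h).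
Proof. by apply: mrg_ext => //=; rewrite map_overlap_id. Qed.

Definition mergemor_id (X : premerge) : mergemor X X :=
  MergeMor (@mergemor_id_mrg X).

Lemma mergemor_comp_mrg (X Y Z : premerge) (g : mergemor Y Z) (f : mergemor X Y)
    (t s : cell2 X) w (h : fits w (out t) (inp s)) :
  mor2 (polymor_comp g f) (mrg h) = mrg (fits_mor (polymor_comp g f) h).
Proof.
by rewrite /= !mor_mrg; apply: mrg_ext => //=; rewrite map_overlap_comp.
Qed.

Definition mergemor_comp (X Y Z : premerge) (g : mergemor Y Z)
  (f : mergemor X Y) : mergemor X Z := MergeMor (mergemor_comp_mrg g f).

Definition MrgBiCat : category.
Proof.
exists mergebicat (fun X Y => mergemor X Y) (fun X => mergemor_id X)
  (fun X Y Z g f => mergemor_comp g f).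
- by move=> *; apply: mergemor_ext.
- by move=> *; apply: mergemor_ext.
- by move=> *; apply: mergemor_ext.
Defined.

Section Free.
Variable P : polygraph.

Inductive fcell : seq (cell1 P) -> seq (cell1 P) -> Type :=
| FGen (p : cell2 P) : fcell (inp p) (out p)
| FMrg i o i' o' (t : fcell i o) (s : fcell i' o') (w : overlap (cell1 P))
    (h : fits w o i') :
    fcell (inp_l w ++ i ++ inp_r w) (out_l w ++ o' ++ out_r w).

Record fterm := FTerm {
  ft_inp : seq (cell1 P);
  ft_out : seq (cell1 P);
  ft_cell : fcell ft_inp ft_out }.

Lemma fcell_neq0 i o (t : fcell i o) : i <> [::] /\ o <> [::].
Proof.
elim: t => {i o} [p|i o i' o' t [Hi Ho] s [Hi' Ho'] w h].
  by split; [apply: inp_neq0 | apply: out_neq0].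
by split; [case: (inp_l w) i Hi {t} | case: (out_l w) o' Ho' {s}] => // -[].
Qed.

Lemma chain_cat (C0 C1 : Type) (s t : C1 -> C0) x l l' y :
  chain s t x (l ++ l') y <-> exists z, chain s t x l z /\ chain s t z l' y.
Proof.
elim: l x => [|a l IH] x /=.
  by split=> [|[z [->]]] //; exists x.
split=> [[sa /IH [z [Hz Hz']]]|[z [[sa Hz] Hz']]]; first by exists z.
by split=> //; apply/IH; exists z.
Qed.

Lemma chain_fun (C0 C1 : Type) (s t : C1 -> C0) x l y x' y' :
  chain s t x l y -> chain s t x' l y' -> l <> [::] -> x = x' /\ y = y'.
Proof.
case: l => // a l /= [-> H] [-> H'] _; split=> //.
by elim: l (t a) H H' => [|b l IH] z /= => [<- <-|[_ H] [_ H']] //; apply: IH H H'.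
Qed.

Lemma fcell_globular i o (t : fcell i o) : exists x y,
  chain (@src P) (@tgt P) x i y /\ chain (@src P) (@tgt P) x o y.
Proof.
elim: t => {i o} [p|i o i' o' t [x [y [Hi Ho]]] s [x' [y' [Hi' Ho']]] w h].
  exact: globular.
case: h Ho Hi' => -> -> Hs Hl Hr.
move=> /chain_cat [u [Hu /chain_cat [v [Hv Hy]]]].
move=> /chain_cat [u' [Hu' /chain_cat [v' [Hv' Hy']]]].
have [e1 e2] := chain_fun Hv Hv' Hs; subst u' v'.
have [x0 [Ha Hb]] : exists x0, chain (@src P) (@tgt P) x0 (inp_l w) x /\
                               chain (@src P) (@tgt P) x0 (out_l w) x'.
  by case: Hl Hu Hu' => -> /= Hu Hu'; subst; [exists x | exists x'].
have [y0 [Hc Hd]] : exists y0, chain (@src P) (@tgt P) y (inp_r w) y0 /\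
                               chain (@src P) (@tgt P) y' (out_r w) y0.
  by case: Hr Hy Hy' => -> /= Hy Hy'; subst; [exists y | exists y'].
exists x0, y0; split; apply/chain_cat.
  by exists x; split=> //; apply/chain_cat; exists y.
by exists x'; split=> //; apply/chain_cat; exists y'.
Qed.

Definition free_poly : polygraph :=
  @Polygraph (cell0 P) (cell1 P) fterm (@src P) (@tgt P) ft_inp ft_out
    (fun t => (fcell_neq0 (ft_cell t)).1)
    (fun t => (fcell_neq0 (ft_cell t)).2)
    (fun t => fcell_globular (ft_cell t)).

Definition free : premerge :=
  @PreMerge free_poly
    (fun t s w h => FTerm (FMrg (ft_cell t) (ft_cell s) h))
    (fun _ _ _ _ => erefl) (fun _ _ _ _ => erefl).

Definition gen (p : cell2 P) : cell2 free := FTerm (FGen p).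

End Free.

Section FreeLift.
Variables (P : polygraph) (M : premerge) (f : polymor P M).

Definition fcell_img (i o : seq (cell1 P)) : Type :=
  {c : cell2 M | inp c = map (mor1 f) i /\ out c = map (mor1 f) o}.

Lemma ev_fits i o i' o' (c : fcell_img i o) (d : fcell_img i' o') w :
  fits w o i' ->
  fits (map_overlap (mor1 f) w) (out (proj1_sig c)) (inp (proj1_sig d)).
Proof.
by move=> /(fits_map (mor1 f)); rewrite (proj2_sig c).2 (proj2_sig d).1.
Qed.

Lemma ev_bdry i o i' o' (c : fcell_img i o) (d : fcell_img i' o') w
    (h : fits w o i') :
  inp (mrg (ev_fits c d h)) = map (mor1 f) (inp_l w ++ i ++ inp_r w) /\
  out (mrg (ev_fits c d h)) = map (mor1 f) (out_l w ++ o' ++ out_r w).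
Proof.
rewrite inp_mrg out_mrg /= !map_cat.
by rewrite (proj2_sig c).1 (proj2_sig d).2.
Qed.

Fixpoint ev i o (t : fcell i o) : fcell_img i o :=
  match t in fcell i o return fcell_img i o with
  | FGen p => exist _ (mor2 f p) (conj (mor_inp f p) (mor_out f p))
  | FMrg _ _ _ _ t s _ h =>
      exist _ (mrg (ev_fits (ev t) (ev s) h)) (ev_bdry (ev t) (ev s) h)
  end.

Definition free_lift_poly : polymor (free P) M :=
  @PolyMor (free P) M (mor0 f) (mor1 f)
    (fun t => proj1_sig (ev (ft_cell t))) (mor_src f) (mor_tgt f)
    (fun t => (proj2_sig (ev (ft_cell t))).1)
    (fun t => (proj2_sig (ev (ft_cell t))).2).

Lemma free_lift_mrg (t s : cell2 (free P)) w (h : fits w (out t) (inp s)) :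
  mor2 free_lift_poly (mrg h) = mrg (fits_mor free_lift_poly h).
Proof. exact: mrg_ext. Qed.

Definition free_lift : mergemor (free P) M := MergeMor free_lift_mrg.

End FreeLift.

Definition gen_mor (P : polygraph) : polymor P (free P).
Proof.
by apply: (@PolyMor P (free P) id id (@gen P)) => * //=; rewrite map_id.
Defined.

Definition free_map (P Q : polygraph) (f : polymor P Q) :
  mergemor (free P) (free Q) := free_lift (polymor_comp (gen_mor Q) f).

(** The merge-bicategory obtained from [X] by imposing the equations [E] between
    parallel 2-cells, together with those of merge-bicategories. *)
Section Quotient.
Variables (X : premerge) (E : cell2 X -> cell2 X -> Prop).
Hypothesis E_par : forall t s, E t s -> inp t = inp s /\ out t = out s.

Inductive cong : cell2 X -> cell2 X -> Prop :=
| cong_refl t : cong t t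
| cong_sym t s : cong t s -> cong s t
| cong_trans t s r : cong t s -> cong s r -> cong t r
| cong_mrg t t' s s' w (h : fits w (out t) (inp s))
    (h' : fits w (out t') (inp s')) :
    cong t t' -> cong s s' -> cong (mrg h) (mrg h')
| cong_law t s : merge_law t s -> cong t s
| cong_eqn t s : E t s -> cong t s.

Lemma cat_mid_nil (A : Type) (a b c : seq A) :
  a ++ b ++ c = [::] -> b = [::].
Proof. by case: a b => [|? ?] []. Qed.

Lemma merge_law_par t s :
  @merge_law X t s -> inp t = inp s /\ out t = out s.
Proof.
case=> {t s} [t s r A M1 L M2 B G1 G2 S1 M S2 H1 H2 h1 h2 h3 h4
             |t s r A L B M C G1 G2 H1 H2 h1 h2 h3 h4
             |t s r A L B M C D1 D2 E1 E2 h1 h2 h3 h4].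
- rewrite !(inp_mrg h2, inp_mrg h4, out_mrg h2, out_mrg h4) /=.
  rewrite !(inp_mrg h1, out_mrg h3) /=.
  case: h1 {h2 h4} h3 => _ _ _ c1 c2 [_ _ _ c3 c4].
  by rewrite -!catA.
- rewrite !(inp_mrg h2, inp_mrg h4, out_mrg h2, out_mrg h4) /=.
  rewrite !(inp_mrg h1, inp_mrg h3) /= -!catA.
  split=> //.
  have [_ _ /= nL _ c2] := h1; have [_ _ /= nM c1 _] := h3.
  have -> : G2 = [::].
    by case: c2 => // /cat_mid_nil.
  have -> : H1 = [::].
    by case: c1 => // /cat_mid_nil.
  by rewrite cats0.
- rewrite !(inp_mrg h2, inp_mrg h4, out_mrg h2, out_mrg h4) /=.
  rewrite !(out_mrg h1, out_mrg h3) /= -!catA.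
  split=> //.
  have [_ _ /= nM c1 _] := h1; have [_ _ /= nL _ c2] := h3.
  have -> : D2 = [::].
    by case: c2 => // /cat_mid_nil.
  have -> : E1 = [::].
    by case: c1 => // /cat_mid_nil.
  by rewrite cats0.
Qed.

Lemma cong_par t s : cong t s -> inp t = inp s /\ out t = out s.
Proof.
elim=> {t s} //.
- by move=> t s _ [-> ->].
- by move=> t s r _ [-> ->] _ [-> ->].
- by move=> t t' s s' w h h' _ [e1 _] _ [_ e2]; rewrite !inp_mrg !out_mrg e1 e2.
- exact: merge_law_par.
Qed.

Definition qcell : Type := {c : cell2 X -> Prop | exists t, c = cong t}.

Definition qpi (t : cell2 X) : qcell := exist _ (cong t) (ex_intro _ t erefl).

Definition qrepr (q : qcell) : cell2 X := proj1_sig (cid (proj2_sig q)).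

Lemma qcell_ext (q r : qcell) : proj1_sig q = proj1_sig r -> q = r.
Proof.
by case: q r => [c H] [d K] /= e; subst d; rewrite (Prop_irrelevance H K).
Qed.

Lemma qreprK q : qpi (qrepr q) = q.
Proof.
by apply: qcell_ext; rewrite /qrepr /=; case: (cid _) => t /= <-.
Qed.

Lemma qpiP t s : qpi t = qpi s <-> cong t s.
Proof.
split=> [/(congr1 (@proj1_sig _ _)) /= ->|c]; first exact: cong_refl.
apply: qcell_ext; apply: funext => r; apply: propext; split=> H.
  by apply: cong_trans H; apply: cong_sym.
exact: cong_trans H.
Qed.

Lemma qrepr_cong t : cong (qrepr (qpi t)) t.
Proof. by apply/qpiP; rewrite qreprK. Qed.

Definition quot_poly : polygraph :=
  @Polygraph (cell0 X) (cell1 X) qcell (@src X) (@tgt X)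
    (fun q => inp (qrepr q)) (fun q => out (qrepr q))
    (fun q => @inp_neq0 X (qrepr q))
    (fun q => @out_neq0 X (qrepr q))
    (fun q => @globular X (qrepr q)).

Lemma quot_inp_mrg (t s : cell2 quot_poly) w (h : fits w (out t) (inp s)) :
  @inp quot_poly (qpi (@mrg X (qrepr t) (qrepr s) w h)) =
  inp_l w ++ inp t ++ inp_r w.
Proof. by rewrite /= (cong_par (qrepr_cong _)).1 inp_mrg. Qed.

Lemma quot_out_mrg (t s : cell2 quot_poly) w (h : fits w (out t) (inp s)) :
  @out quot_poly (qpi (@mrg X (qrepr t) (qrepr s) w h)) =
  out_l w ++ out s ++ out_r w.
Proof. by rewrite /= (cong_par (qrepr_cong _)).2 out_mrg. Qed.

Definition quot_pre : premerge :=
  @PreMerge quot_poly (fun t s w h => qpi (@mrg X (qrepr t) (qrepr s) w h))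
    quot_inp_mrg quot_out_mrg.

Lemma fits_qpi (t s : cell2 X) w :
  fits w (out t) (inp s) ->
  fits w (@out quot_pre (qpi t)) (@inp quot_pre (qpi s)).
Proof.
by rewrite /= (cong_par (qrepr_cong _)).1 (cong_par (qrepr_cong _)).2.
Qed.

Lemma qpi_mrg (t s : cell2 X) w (h : fits w (out t) (inp s))
    (h' : fits w (@out quot_pre (qpi t)) (@inp quot_pre (qpi s))) :
  qpi (@mrg X t s w h) = @mrg quot_pre _ _ _ h'.
Proof.
by apply/qpiP/cong_mrg; apply: cong_sym; apply: qrepr_cong.
Qed.

Lemma quot_mrgE (t s : cell2 X) w
    (h : fits w (@out quot_pre (qpi t)) (@inp quot_pre (qpi s))) :
  exists h' : fits w (out t) (inp s), @mrg quot_pre _ _ _ h = qpi (@mrg X t s w h').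
Proof.
have h' : fits w (out t) (inp s).
  by move: h; rewrite /= (cong_par (qrepr_cong _)).1 (cong_par (qrepr_cong _)).2.
by exists h'; rewrite (qpi_mrg h' h).
Qed.

Lemma quot_inp t : @inp quot_pre (qpi t) = inp t.
Proof. exact: (cong_par (qrepr_cong _)).1. Qed.

Lemma quot_out t : @out quot_pre (qpi t) = out t.
Proof. exact: (cong_par (qrepr_cong _)).2. Qed.

Lemma quot_merge_eq (u v : cell2 quot_pre) : merge_law u v -> u = v.
Proof.
case=> {u v} t s r; rewrite -(qreprK t) -(qreprK s) -(qreprK r).
- move: (qrepr t) (qrepr s) (qrepr r) => {}t {}s {}r.
  move=> A M1 L M2 B G1 G2 S1 M S2 H1 H2 h1.
  have [k1 ->] := quot_mrgE h1 => h2; have [k2 ->] := quot_mrgE h2.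
  move=> h3; have [k3 ->] := quot_mrgE h3 => h4; have [k4 ->] := quot_mrgE h4.
  by apply/qpiP/cong_law; apply: law_assoc.
- move: (qrepr t) (qrepr s) (qrepr r) => {}t {}s {}r A L B M C G1 G2 H1 H2 h1.
  rewrite (quot_out s).
  rewrite (quot_out r).
  have [k1 ->] := quot_mrgE h1 => h2; have [k2 ->] := quot_mrgE h2.
  move=> h3; have [k3 ->] := quot_mrgE h3 => h4; have [k4 ->] := quot_mrgE h4.
  by apply/qpiP/cong_law; apply: law_out.
- move: (qrepr t) (qrepr s) (qrepr r) => {}t {}s {}r A L B M C D1 D2 E1 E2 h1.
  rewrite (quot_inp s).
  rewrite (quot_inp t).
  have [k1 ->] := quot_mrgE h1 => h2; have [k2 ->] := quot_mrgE h2.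
  move=> h3; have [k3 ->] := quot_mrgE h3 => h4; have [k4 ->] := quot_mrgE h4.
  by apply/qpiP/cong_law; apply: law_inp.
Qed.

Definition quot : mergebicat := MergeBicat quot_merge_eq.

End Quotient.

Lemma mor_mrg_eq (X Y : premerge) (f : mergemor X Y) (t s : cell2 X) t' s' w
    (h : fits w (out t) (inp s)) :
  mor2 f t = t' -> mor2 f s = s' ->
  exists h' : fits (map_overlap (mor1 f) w) (out t') (inp s'),
    mor2 f (mrg h) = mrg h'.
Proof.
by move=> <- <-; exists (fits_mor f h); apply: mor_mrg.
Qed.

Arguments mor_mrg_eq {X Y} f {t s t' s' w} h.

Lemma mor_merge_law (X Y : premerge) (f : mergemor X Y) t s :
  merge_law t s -> merge_law (mor2 f t) (mor2 f s).
Proof.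
case=> {}t {}s r.
- move=> A M1 L M2 B G1 G2 S1 M S2 H1 H2 h1 h2 h3 h4.
  have [k1 e1] := mor_mrg_eq f h1 erefl erefl.
  have [k2 ->] := mor_mrg_eq f h2 e1 erefl.
  have [k3 e3] := mor_mrg_eq f h3 erefl erefl.
  have [k4 ->] := mor_mrg_eq f h4 erefl e3.
  move: k1 {e1} k2 k3 {e3} k4; rewrite /map_overlap /= !map_cat => *.
  exact: law_assoc.
- move=> A L B M C G1 G2 H1 H2 h1 h2 h3 h4.
  have [k1 e1] := mor_mrg_eq f h1 erefl erefl.
  have [k2 ->] := mor_mrg_eq f h2 e1 erefl.
  have [k3 e3] := mor_mrg_eq f h3 erefl erefl.
  have [k4 ->] := mor_mrg_eq f h4 e3 erefl.
  move: k1 {e1} k2 k3 {e3} k4.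
  rewrite /map_overlap /= !map_cat -!mor_out => *.
  exact: law_out.
- move=> A L B M C D1 D2 E1 E2 h1 h2 h3 h4.
  have [k1 e1] := mor_mrg_eq f h1 erefl erefl.
  have [k2 ->] := mor_mrg_eq f h2 erefl e1.
  have [k3 e3] := mor_mrg_eq f h3 erefl erefl.
  have [k4 ->] := mor_mrg_eq f h4 erefl e3.
  move: k1 {e1} k2 k3 {e3} k4.
  rewrite /map_overlap /= !map_cat -!mor_inp => *.
  exact: law_inp.
Qed.

Section QuotientMap.
Variables (X Y : premerge) (f : mergemor X Y).
Variables (E : cell2 X -> cell2 X -> Prop) (F : cell2 Y -> cell2 Y -> Prop).
Hypothesis E_par : forall t s, E t s -> inp t = inp s /\ out t = out s.
Hypothesis F_par : forall t s, F t s -> inp t = inp s /\ out t = out s.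
Hypothesis fE : forall t s, E t s -> F (mor2 f t) (mor2 f s).

Lemma cong_map t s : cong E t s -> cong F (mor2 f t) (mor2 f s).
Proof.
elim=> {t s}.
- by move=> t; apply: cong_refl.
- by move=> t s _; apply: cong_sym.
- by move=> t s r _ c _; apply: cong_trans.
- by move=> t t' s s' w h h' _ c _ d; rewrite !mor_mrg; apply: cong_mrg.
- by move=> t s /(mor_merge_law f); apply: cong_law.
- by move=> t s /fE; apply: cong_eqn.
Qed.

Lemma quot_map_inp (q : cell2 (quot E_par)) :
  @inp (quot F_par) (qpi F (mor2 f (qrepr q))) = map (mor1 f) (inp q).
Proof. by rewrite /= (cong_par F_par (qrepr_cong _ _)).1 mor_inp. Qed.

Lemma quot_map_out (q : cell2 (quot E_par)) :
  @out (quot F_par) (qpi F (mor2 f (qrepr q))) = map (mor1 f) (out q).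
Proof. by rewrite /= (cong_par F_par (qrepr_cong _ _)).2 mor_out. Qed.

Definition quot_map_poly : polymor (quot E_par) (quot F_par) :=
  @PolyMor (quot E_par) (quot F_par) (mor0 f) (mor1 f)
    (fun q => qpi F (mor2 f (qrepr q))) (mor_src f) (mor_tgt f)
    quot_map_inp quot_map_out.

Lemma quot_map_mrg (t s : cell2 (quot E_par)) w (h : fits w (out t) (inp s)) :
  mor2 quot_map_poly (mrg h) = mrg (fits_mor quot_map_poly h).
Proof.
have -> : mor2 quot_map_poly (mrg h) =
          qpi F (mor2 f (@mrg X (qrepr t) (qrepr s) w h)).
  by apply/qpiP/cong_map/qrepr_cong.
rewrite mor_mrg.
exact: (@qpi_mrg Y F F_par _ _ _ (fits_mor f h)).
Qed.

Definition quot_map : mergemor (quot E_par) (quot F_par) :=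
  MergeMor quot_map_mrg.

End QuotientMap.

(** [col [:: p_1; ...; p_n] t] and [row [:: p_1; ...; p_n] t]: [t] is the
    composite of the [p_k], where consecutive cells are merged along a single
    1-cell.  In a column it is the first output of [p_(k+1)] and the last input
    of [p_k]; in a row it is the last output of [p_k] and the first input of
    [p_(k+1)]. *)
Inductive col (X : premerge) : seq (cell2 X) -> cell2 X -> Prop :=
| col1 p : col [:: p] p
| colS p l t e D G (h : fits (Overlap [::] [:: e] D G [::]) (out t) (inp p)) :
    col l t -> col (p :: l) (mrg h).

Inductive row (X : premerge) : seq (cell2 X) -> cell2 X -> Prop :=
| row1 p : row [:: p] p
| rowS p l t e D G (h : fits (Overlap D [:: e] [::] [::] G) (out p) (inp t)) :
    row l t -> row (p :: l) (mrg h).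

Lemma mor_col (X Y : premerge) (f : mergemor X Y) l t :
  col l t -> col (map (mor2 f) l) (mor2 f t).
Proof.
elim=> {l t} [p|p l t e D G h _ IH] /=; first exact: col1.
by rewrite mor_mrg; apply: colS.
Qed.

Lemma mor_row (X Y : premerge) (f : mergemor X Y) l t :
  row l t -> row (map (mor2 f) l) (mor2 f t).
Proof.
elim=> {l t} [p|p l t e D G h _ IH] /=; first exact: row1.
by rewrite mor_mrg; apply: rowS.
Qed.

Section Gray.
Variables X Y : mergebicat.

Inductive gray_cell1 :=
| G01 (x : cell0 X) (b : cell1 Y)
| G10 (a : cell1 X) (y : cell0 Y).

Inductive gray_gen :=
| G02 (x : cell0 X) (p : cell2 Y)
| G20 (p : cell2 X) (y : cell0 Y)
| G11 (a : cell1 X) (b : cell1 Y).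

Definition gray_src (u : gray_cell1) : cell0 X * cell0 Y :=
  match u with G01 x b => (x, src b) | G10 a y => (src a, y) end.

Definition gray_tgt (u : gray_cell1) : cell0 X * cell0 Y :=
  match u with G01 x b => (x, tgt b) | G10 a y => (tgt a, y) end.

Definition gray_inp (g : gray_gen) : seq gray_cell1 :=
  match g with
  | G02 x p => map (G01 x) (inp p)
  | G20 p y => map (G10^~ y) (inp p)
  | G11 a b => [:: G01 (src a) b; G10 a (tgt b)]
  end.

Definition gray_out (g : gray_gen) : seq gray_cell1 :=
  match g with
  | G02 x p => map (G01 x) (out p)
  | G20 p y => map (G10^~ y) (out p)
  | G11 a b => [:: G10 a (src b); G01 (tgt a) b]
  end.

Lemma gray_inp_neq0 g : gray_inp g <> [::].
Proof.
case: g => [x p|p y|a b] //=.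
  by case: (inp p) (@inp_neq0 _ p).
by case: (inp p) (@inp_neq0 _ p).
Qed.

Lemma gray_out_neq0 g : gray_out g <> [::].
Proof.
case: g => [x p|p y|a b] //=.
  by case: (out p) (@out_neq0 _ p).
by case: (out p) (@out_neq0 _ p).
Qed.

Lemma chain_G01 x y l y' : chain (@src Y) (@tgt Y) y l y' ->
  chain gray_src gray_tgt (x, y) (map (G01 x) l) (x, y').
Proof. by elim: l y => [|b l IH] y /= => [->|[<- /IH]]. Qed.

Lemma chain_G10 y x l x' : chain (@src X) (@tgt X) x l x' ->
  chain gray_src gray_tgt (x, y) (map (G10^~ y) l) (x', y).
Proof. by elim: l x => [|a l IH] x /= => [->|[<- /IH]]. Qed.

Lemma gray_globular g : exists u v,
  chain gray_src gray_tgt u (gray_inp g) v /\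
  chain gray_src gray_tgt u (gray_out g) v.
Proof.
case: g => [x p|p y|a b] /=.
- have [y [y' [Hi Ho]]] := globular p.
  by exists (x, y), (x, y'); split; apply: chain_G01.
- have [x [x' [Hi Ho]]] := globular p.
  by exists (x, y), (x', y); split; apply: chain_G10.
- by exists (src a, src b), (tgt a, tgt b).
Qed.

Definition gray_poly : polygraph :=
  @Polygraph (cell0 X * cell0 Y) gray_cell1 gray_gen gray_src gray_tgt
    gray_inp gray_out gray_inp_neq0 gray_out_neq0 gray_globular.

Local Notation T := (free gray_poly).
Local Notation "[ 'gen' g ]" := (@gen gray_poly g : cell2 T).
Local Notation mrgT h := (@mrg T _ _ _ h).

(** In [gray_eq2] and [gray_eq3], [t] and [s] range over the composites of the
    indicated squares; these exist by [col_square] and [row_square] below. *)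
Inductive gray_eq : cell2 T -> cell2 T -> Prop :=
| gray_eq1l x (p q : cell2 Y) w (h : fits w (out p) (inp q))
    (h' : fits (map_overlap (G01 x) w) (out [gen G02 x p]) (inp [gen G02 x q])) :
    gray_eq [gen G02 x (mrg h)] (mrgT h')
| gray_eq1r y (p q : cell2 X) w (h : fits w (out p) (inp q))
    (h' : fits (map_overlap (G10^~ y) w)
               (out [gen G20 p y]) (inp [gen G20 q y])) :
    gray_eq [gen G20 (mrg h) y] (mrgT h')
| gray_eq2 (c : cell1 X) (p : cell2 Y) y y' (t s : cell2 T)
    (h : fits (Overlap [::] (map (G01 (src c)) (out p)) [::] [::] [:: G10 c y'])
              (out [gen G02 (src c) p]) (inp t))
    (h' : fits (Overlap [:: G10 c y] (map (G01 (tgt c)) (inp p)) [::] [::] [::])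
              (out s) (inp [gen G02 (tgt c) p])) :
    chain (@src Y) (@tgt Y) y (inp p) y' ->
    col [seq [gen G11 c b] | b <- out p] t ->
    col [seq [gen G11 c a] | a <- inp p] s ->
    gray_eq (mrgT h) (mrgT h')
| gray_eq3 (c : cell1 Y) (p : cell2 X) x x' (t s : cell2 T)
    (h : fits (Overlap [::] (map (G10^~ (tgt c)) (out p)) [::] [:: G01 x c] [::])
              (out [gen G20 p (tgt c)]) (inp t))
    (h' : fits (Overlap [::] (map (G10^~ (src c)) (inp p)) [:: G01 x' c] [::] [::])
              (out s) (inp [gen G20 p (src c)])) :
    chain (@src X) (@tgt X) x (inp p) x' ->
    row [seq [gen G11 b c] | b <- out p] t ->
    row [seq [gen G11 a c] | a <- inp p] s ->
    gray_eq (mrgT h) (mrgT h').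

Lemma gray_eq2E (c : cell1 X) (p : cell2 Y) y y' (t s u v : cell2 T) w w'
    (h : fits w (out u) (inp t)) (h' : fits w' (out s) (inp v)) :
  w = Overlap [::] (map (G01 (src c)) (out p)) [::] [::] [:: G10 c y'] ->
  w' = Overlap [:: G10 c y] (map (G01 (tgt c)) (inp p)) [::] [::] [::] ->
  u = [gen G02 (src c) p] -> v = [gen G02 (tgt c) p] ->
  chain (@src Y) (@tgt Y) y (inp p) y' ->
  col [seq [gen G11 c b] | b <- out p] t ->
  col [seq [gen G11 c a] | a <- inp p] s ->
  gray_eq (mrgT h) (mrgT h').
Proof. by move=> ? ? ? ?; subst; apply: gray_eq2. Qed.

Lemma gray_eq3E (c : cell1 Y) (p : cell2 X) x x' (t s u v : cell2 T) w w'
    (h : fits w (out u) (inp t)) (h' : fits w' (out s) (inp v)) :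
  w = Overlap [::] (map (G10^~ (tgt c)) (out p)) [::] [:: G01 x c] [::] ->
  w' = Overlap [::] (map (G10^~ (src c)) (inp p)) [:: G01 x' c] [::] [::] ->
  u = [gen G20 p (tgt c)] -> v = [gen G20 p (src c)] ->
  chain (@src X) (@tgt X) x (inp p) x' ->
  row [seq [gen G11 b c] | b <- out p] t ->
  row [seq [gen G11 a c] | a <- inp p] s ->
  gray_eq (mrgT h) (mrgT h').
Proof. by move=> ? ? ? ?; subst; apply: gray_eq3. Qed.

Lemma col_square_bdry (c : cell1 X) l (t : cell2 T) y y' :
  col [seq [gen G11 c b] | b <- l] t -> chain (@src Y) (@tgt Y) y l y' ->
  inp t = map (G01 (src c)) l ++ [:: G10 c y'] /\
  out t = G10 c y :: map (G01 (tgt c)) l.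
Proof.
move E: [seq _ | b <- l] => sq H.
elim: H l E y => {sq t} [p|p sq t e D G h _ IH] [|b l] //= [ep E] y [<- H]; subst p.
  by case: l E H => //= _ <-.
have {IH} [/= ei eo] := IH l E _ H; rewrite ei.
case: h => /=; rewrite eo => -[<- <-].
by case: G => [|a [|? []]] //= [<-] _ _ _; rewrite ?cats0.
Qed.

Lemma row_square_bdry (c : cell1 Y) l (t : cell2 T) x x' :
  row [seq [gen G11 a c] | a <- l] t -> chain (@src X) (@tgt X) x l x' ->
  inp t = G01 x c :: map (G10^~ (tgt c)) l /\
  out t = map (G10^~ (src c)) l ++ [:: G01 x' c].
Proof.
move E: [seq _ | b <- l] => sq H.
elim: H l E x => {sq t} [p|p sq t e D G h _ IH] [|b l] //= [ep E] x [<- H]; subst p.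
  by case: l E H => //= _ <-.
have {IH} [/= ei eo] := IH l E _ H; rewrite eo.
case: h => /=; rewrite ei => + -[<- <-].
by case: D => [|a [|? []]] //= [<-] _ _ _; rewrite ?cats0.
Qed.

Lemma col_square (c : cell1 X) l y y' :
  l <> [::] -> chain (@src Y) (@tgt Y) y l y' ->
  exists t, col [seq [gen G11 c b] | b <- l] t.
Proof.
elim: l y => // b l IH y _ [_ H]; case: l IH H => [|b' l] IH H.
  by eexists; apply: col1.
have [|t Ht] := IH (tgt b) _ H; first by [].
have [_ eo] := col_square_bdry Ht H.
have h : fits (Overlap [::] [:: G10 c (tgt b)] (map (G01 (tgt c)) (b' :: l))
                 [:: G01 (src c) b] [::]) (out t) (inp [gen G11 c b]).
  by rewrite eo; split=> //=; [right | left].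
by eexists; apply: (@colS T _ _ _ _ _ _ h Ht).
Qed.

Lemma row_square (c : cell1 Y) l x x' :
  l <> [::] -> chain (@src X) (@tgt X) x l x' ->
  exists t, row [seq [gen G11 a c] | a <- l] t.
Proof.
elim: l x => // b l IH x _ [_ H]; case: l IH H => [|b' l] IH H.
  by eexists; apply: row1.
have [|t Ht] := IH (tgt b) _ H; first by [].
have [ei _] := row_square_bdry Ht H.
have h : fits (Overlap [:: G10 b (src c)] [:: G01 (tgt b) c] [::] [::]
                 (map (G10^~ (tgt c)) (b' :: l))) (out [gen G11 b c]) (inp t).
  by rewrite ei; split=> //=; [left | right].
by eexists; apply: (@rowS T _ _ _ _ _ _ h Ht).
Qed.

Lemma chain_out (Z : polygraph) (p : cell2 Z) x y :
  chain (@src Z) (@tgt Z) x (inp p) y -> chain (@src Z) (@tgt Z) x (out p) y.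
Proof.
have [x' [y' [Hi Ho]]] := globular p => H.
by have [-> ->] := chain_fun H Hi (@inp_neq0 _ p).
Qed.

Lemma gray_par t s : gray_eq t s -> inp t = inp s /\ out t = out s.
Proof.
case=> {t s}.
- by move=> x p q w h h'; rewrite inp_mrg out_mrg /= inp_mrg out_mrg !map_cat.
- by move=> y p q w h h'; rewrite inp_mrg out_mrg /= inp_mrg out_mrg !map_cat.
- move=> c p y y' t s h h' H Ht Hs; rewrite !inp_mrg !out_mrg.
  rewrite (col_square_bdry Hs H).1 (col_square_bdry Ht (chain_out H)).2 /=.
  by rewrite !cats0.
- move=> c p x x' t s h h' H Ht Hs; rewrite !inp_mrg !out_mrg.
  rewrite (row_square_bdry Hs H).1 (row_square_bdry Ht (chain_out H)).2 /=.
  by rewrite !cats0.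
Qed.

Definition gray : mergebicat := quot gray_par.

Definition gray_cell2 (u : gray_gen) : cell2 gray :=
  qpi gray_eq (@gen gray_poly u).

End Gray.

Section GrayMap.
Variables (X X' Y Y' : mergebicat) (f : mergemor X X') (g : mergemor Y Y').

Definition gray_map0 (u : cell0 X * cell0 Y) : cell0 X' * cell0 Y' :=
  (mor0 f u.1, mor0 g u.2).

Definition gray_map1 (u : gray_cell1 X Y) : gray_cell1 X' Y' :=
  match u with
  | G01 x b => G01 (mor0 f x) (mor1 g b)
  | G10 a y => G10 (mor1 f a) (mor0 g y)
  end.

Definition gray_map2 (u : gray_gen X Y) : gray_gen X' Y' :=
  match u with
  | G02 x p => G02 (mor0 f x) (mor2 g p)
  | G20 p y => G20 (mor2 f p) (mor0 g y)
  | G11 a b => G11 (mor1 f a) (mor1 g b)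
  end.

Definition gray_map_poly : polymor (gray_poly X Y) (gray_poly X' Y').
Proof.
exists gray_map0 gray_map1 gray_map2.
- by case=> [x b|a y] /=; rewrite mor_src.
- by case=> [x b|a y] /=; rewrite mor_tgt.
- by case=> [x p|p y|a b] /=; rewrite ?mor_inp ?mor_src ?mor_tgt // -!map_comp.
- by case=> [x p|p y|a b] /=; rewrite ?mor_out ?mor_src ?mor_tgt // -!map_comp.
Defined.

Local Notation H := (free_map gray_map_poly).

Lemma map_square_col c l :
  map (mor2 H) [seq @gen (gray_poly X Y) (G11 c b) | b <- l] =
  [seq @gen (gray_poly X' Y') (G11 (mor1 f c) b) | b <- map (mor1 g) l].
Proof. by rewrite -!map_comp. Qed.

Lemma map_square_row c l :
  map (mor2 H) [seq @gen (gray_poly X Y) (G11 a c) | a <- l] =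
  [seq @gen (gray_poly X' Y') (G11 a (mor1 g c)) | a <- map (mor1 f) l].
Proof. by rewrite -!map_comp. Qed.

Lemma mor_chain (Z W : polygraph) (k : polymor Z W) x l y :
  chain (@src Z) (@tgt Z) x l y ->
  chain (@src W) (@tgt W) (mor0 k x) (map (mor1 k) l) (mor0 k y).
Proof.
elim: l x => [|a l IH] x /= => [->|[<- /IH]] //.
by rewrite mor_src mor_tgt.
Qed.

Lemma gray_map_eq t s : gray_eq t s -> gray_eq (mor2 H t) (mor2 H s).
Proof.
case=> {t s}.
- move=> x p q w h h'.
  have [k' ->] := mor_mrg_eq H h' erefl erefl.
  have -> : mor2 H (@gen (gray_poly X Y) (G02 x (mrg h))) =
            @gen (gray_poly X' Y') (G02 (mor0 f x) (mrg (fits_mor g h))).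
    by rewrite -mor_mrg.
  move: k'; rewrite -map_overlap_comp.
  rewrite (map_overlap_comp (G01 (mor0 f x)) (mor1 g)) => k'.
  exact: gray_eq1l.
- move=> y p q w h h'.
  have [k' ->] := mor_mrg_eq H h' erefl erefl.
  have -> : mor2 H (@gen (gray_poly X Y) (G20 (mrg h) y)) =
            @gen (gray_poly X' Y') (G20 (mrg (fits_mor f h)) (mor0 g y)).
    by rewrite -mor_mrg.
  move: k'; rewrite -map_overlap_comp.
  rewrite (map_overlap_comp (fun a : cell1 X' => G10 a (mor0 g y)) (mor1 f)) => k'.
  exact: gray_eq1r.
- move=> c p y y' t s h h' Hc Ht Hs.
  have [k ->] := mor_mrg_eq H h erefl erefl.
  have [k' ->] := mor_mrg_eq H h' erefl erefl.
  apply: (@gray_eq2E _ _ (mor1 f c) (mor2 g p) (mor0 g y) (mor0 g y')) => /=.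
  + by rewrite mor_src mor_out /map_overlap /= -!map_comp.
  + by rewrite mor_tgt mor_inp /map_overlap /= -!map_comp.
  + by rewrite mor_src.
  + by rewrite mor_tgt.
  + by rewrite mor_inp; apply: mor_chain.
  + by rewrite mor_out -map_square_col; apply: mor_col.
  + by rewrite mor_inp -map_square_col; apply: mor_col.
- move=> c p x x' t s h h' Hc Ht Hs.
  have [k ->] := mor_mrg_eq H h erefl erefl.
  have [k' ->] := mor_mrg_eq H h' erefl erefl.
  apply: (@gray_eq3E _ _ (mor1 g c) (mor2 f p) (mor0 f x) (mor0 f x')) => /=.
  + by rewrite mor_tgt mor_out /map_overlap /= -!map_comp.
  + by rewrite mor_src mor_inp /map_overlap /= -!map_comp.
  + by rewrite mor_tgt.
  + by rewrite mor_src.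
  + by rewrite mor_inp; apply: mor_chain.
  + by rewrite mor_out -map_square_row; apply: mor_row.
  + by rewrite mor_inp -map_square_row; apply: mor_row.
Qed.

Definition gray_map : mergemor (gray X Y) (gray X' Y') :=
  quot_map (gray_par (Y:=Y)) (gray_par (Y:=Y')) gray_map_eq.

Lemma gray_map_gen (u : gray_gen X Y) :
  mor2 gray_map (gray_cell2 u) = gray_cell2 (gray_map2 u).
Proof.
apply/qpiP.
exact: (cong_map (f := H) gray_map_eq (qrepr_cong (gray_eq (Y:=Y)) (gen _))).
Qed.

End GrayMap.

Definition merge_one : mergebicat.
Proof.
unshelve refine (@MergeBicat (@PreMerge (@Polygraph unit Empty_set Empty_set
  (fun=> tt) (fun=> tt) (fun=> [::]) (fun=> [::]) _ _ _)
  (fun t _ _ _ => t) _ _) _).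
all: by case.
Defined.

(* Main.v *)
From mathcomp Require Import all_boot.
From mathcomp Require Import boolp.
Require Import Defs.

Set Implicit Arguments.
Unset Strict Implicit.
Unset Printing Implicit Defensive.

(** The Gray product is presented by generators and relations, hence has a
    universal property.  A morphism out of [gray X Y] amounts to morphisms
    [L y] out of [X], morphisms [R x] out of [Y] and squares [S a b], such that
    the squares [S a c] assemble into rows natural in the 2-cells of [X] and the
    squares [S c b] into columns natural in the 2-cells of [Y] ([gray_lift]).
    Two such morphisms are equal as soon as these three families agree
    ([gray_hom_ext]).  Applying this once for each nested product reduces
    functoriality, naturality, invertibility, triangle and pentagon to
    computations on generators.

    What remains is to construct the associator and its inverse.  The families
    [L], [R] and [S] are dictated by the formula for the 1-cells, but the
    morphism from [gray (gray A B) D] must have rows natural in every 2-cell of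
    [gray A B], and its inverse must have columns natural in every 2-cell of
    [gray B D], while the relations speak of generators only.  Induction on
    these 2-cells works thanks to two facts.

    The first is that natural 2-cells are closed under merging
    ([row_natural_mrg]).  A row of squares below the merge of [p] and [q] is
    moved over [q] and then over [p].  At both moments the cell that moves only
    meets a middle segment of the row; associativity and interchange let the
    remaining squares of the row slide past it ([row_natural_whisker]).
    Columns are rows for the opposite orientation of 2-cells ([co]), so that
    only rows have to be treated.

    The second concerns a generating square: naturality of a row in the square
    of [a] and [b], with respect to a 1-cell [d], is an equation between two
    composites of three squares, the two halves of a cube.  Reassociating each
    half turns it into the naturality of a column in the square of [b] and [d],
    with respect to [a] ([hexagonE]).  The latter is a defining relation of the
    other bracketing, and conversely.

    The unitors are immediate, since the unit has no 1-cells or 2-cells. *)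

(** * Merging as a total operation *)

Section TotalMerge.
Variable X : premerge.
Implicit Types (t s r : cell2 X) (w : overlap (cell1 X)).

(** A merge carries the proof that its boundaries match, which obstructs
    rewriting inside [t] and [s].  Off its domain [mg] takes an arbitrary value,
    here [t]. *)
Definition mg w t s : cell2 X :=
  if pselect (fits w (out t) (inp s)) is left h then mrg h else t.

Lemma mgE w t s (h : fits w (out t) (inp s)) : mrg h = mg w t s.
Proof. by rewrite /mg; case: pselect => // k; apply: mrg_ext. Qed.

Lemma inp_mg w t s : fits w (out t) (inp s) ->
  inp (mg w t s) = inp_l w ++ inp t ++ inp_r w.
Proof. by move=> h; rewrite -(mgE h) inp_mrg. Qed.

Lemma out_mg w t s : fits w (out t) (inp s) ->
  out (mg w t s) = out_l w ++ out s ++ out_r w.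
Proof. by move=> h; rewrite -(mgE h) out_mrg. Qed.

End TotalMerge.


Lemma cat_eq0 (A : Type) (l l' : seq A) : l ++ l' = [::] -> l = [::] /\ l' = [::].
Proof. by case: l. Qed.

Lemma cat_neq0 (A : Type) (a l b : seq A) : l <> [::] -> a ++ l ++ b <> [::].
Proof. by move=> nl /cat_eq0 [_ /cat_eq0 []]. Qed.

Lemma cat_comm0 (A : Type) (l l' : seq A) :
  l = [::] \/ l' = [::] -> l ++ l' = l' ++ l.
Proof. by case=> ->; rewrite cats0. Qed.

Section Laws.
Variable X : mergebicat.
Implicit Types (t s r : cell2 X).

(** The two outer merges of the associativity law are defined as soon as the
    two inner ones are and [H1], [A] and [H2], [B] do not compete for the same
    side: where an overlap has material on one side of the shared part, the other
    cell has none there, so the remaining segments commute. *)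
Lemma mg_assoc t s r A M1 L M2 B G1 G2 S1 M S2 H1 H2 :
  fits (Overlap (A ++ M1) L (M2 ++ B) G1 G2) (out t) (inp s) ->
  fits (Overlap S1 M S2 (H1 ++ M1) (M2 ++ H2)) (out s) (inp r) ->
  H1 = [::] \/ A = [::] -> H2 = [::] \/ B = [::] ->
  mg (Overlap (A ++ S1) (M1 ++ M ++ M2) (S2 ++ B) H1 H2)
     (mg (Overlap (A ++ M1) L (M2 ++ B) G1 G2) t s) r =
  mg (Overlap A (M1 ++ L ++ M2) B (H1 ++ G1) (G2 ++ H2)) t
     (mg (Overlap S1 M S2 (H1 ++ M1) (M2 ++ H2)) s r).
Proof.
move=> h1 h3 cl cr.
have [/= ot iS nL a1 a2] := h1; have [/= os ir nM a3 a4] := h3.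
have [b1 c1] : (H1 = [::] \/ S1 = [::]) /\ (M1 = [::] \/ S1 = [::]).
  by case: a3 => [/cat_eq0 [-> ->] | ->]; split; auto.
have [b2 c2] : (H2 = [::] \/ S2 = [::]) /\ (M2 = [::] \/ S2 = [::]).
  by case: a4 => [/cat_eq0 [-> ->] | ->]; split; auto.
have [b3 c3] : (G1 = [::] \/ A = [::]) /\ (G1 = [::] \/ M1 = [::]).
  by case: a1 => [-> | /cat_eq0 [-> ->]]; split; auto.
have [b4 c4] : (G2 = [::] \/ B = [::]) /\ (G2 = [::] \/ M2 = [::]).
  by case: a2 => [-> | /cat_eq0 [-> ->]]; split; auto.
have h2 : fits (Overlap (A ++ S1) (M1 ++ M ++ M2) (S2 ++ B) H1 H2)
               (out (mrg h1)) (inp r).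
  rewrite out_mrg os ir; split=> /=; last 3 first.
  - exact: cat_neq0.
  - by case: b1 => ->; [left | case: cl => ->; [left | right]].
  - by case: b2 => ->; [left | case: cr => ->; [left | right]].
  - rewrite -!catA; congr (_ ++ _); rewrite !catA (cat_comm0 c1); congr (_ ++ _).
    by rewrite -!catA (cat_comm0 c2).
  - by rewrite -!catA.
have h4 : fits (Overlap A (M1 ++ L ++ M2) B (H1 ++ G1) (G2 ++ H2))
               (out t) (inp (mrg h3)).
  rewrite inp_mrg ot iS; split=> /=; last 3 first.
  - exact: cat_neq0.
  - by case: b3 => ->; [case: cl => ->; [left | right] | right].
  - by case: b4 => ->; [case: cr => ->; [left | right] | right].
  - by rewrite -!catA.
  - rewrite -!catA; congr (_ ++ _); rewrite !catA (cat_comm0 c3) -!catA.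
    by do 3!congr (_ ++ _); rewrite !catA (cat_comm0 c4).
move: (h2) (h4); rewrite !mgE => k2 k4; rewrite -(mgE k2) -(mgE k4).
move: k2 k4; rewrite -(mgE h1) -(mgE h3) => k2 k4.
exact/merge_eq/law_assoc.
Qed.

Lemma mg_out_out t s r A L B M C G1 G2 H1 H2 :
  fits (Overlap A L (B ++ M ++ C) G1 G2) (out t) (inp s) ->
  fits (Overlap (A ++ L ++ B) M C H1 H2) (out t) (inp r) ->
  mg (Overlap (A ++ out s ++ B) M C H1 H2)
     (mg (Overlap A L (B ++ M ++ C) G1 G2) t s) r =
  mg (Overlap A L (B ++ out r ++ C) G1 G2)
     (mg (Overlap (A ++ L ++ B) M C H1 H2) t r) s.
Proof.
move=> h1 h3.
have [/= ot iS nL a1 a2] := h1; have [/= _ ir nM a3 a4] := h3.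
have eG : G2 = [::] by case: a2 => // /cat_mid_nil.
have eH : H1 = [::] by case: a3 => // /cat_mid_nil.
have h2 : fits (Overlap (A ++ out s ++ B) M C H1 H2) (out (mrg h1)) (inp r).
  by rewrite out_mrg; split=> //=; [rewrite -!catA | left].
have h4 : fits (Overlap A L (B ++ out r ++ C) G1 G2) (out (mrg h3)) (inp s).
  by rewrite out_mrg; split=> //=; [rewrite -!catA | left].
move: (h2) (h4); rewrite !mgE => k2 k4; rewrite -(mgE k2) -(mgE k4).
move: k2 k4; rewrite -(mgE h1) -(mgE h3) => k2 k4.
exact/merge_eq/law_out.
Qed.

Lemma mg_inp_inp t s r A L B M C D1 D2 E1 E2 :
  fits (Overlap E1 M E2 (A ++ L ++ B) C) (out s) (inp r) ->
  fits (Overlap D1 L D2 A (B ++ M ++ C)) (out t) (inp r) ->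
  mg (Overlap D1 L D2 A (B ++ inp s ++ C)) t
     (mg (Overlap E1 M E2 (A ++ L ++ B) C) s r) =
  mg (Overlap E1 M E2 (A ++ inp t ++ B) C) s
     (mg (Overlap D1 L D2 A (B ++ M ++ C)) t r).
Proof.
move=> h1 h3.
have [/= os ir nM a1 a2] := h1; have [/= ot _ nL a3 a4] := h3.
have eE : E1 = [::] by case: a1 => // /cat_mid_nil.
have eD : D2 = [::] by case: a4 => // /cat_mid_nil.
have h2 : fits (Overlap D1 L D2 A (B ++ inp s ++ C)) (out t) (inp (mrg h1)).
  by rewrite inp_mrg; split=> //=; [rewrite -!catA | right].
have h4 : fits (Overlap E1 M E2 (A ++ inp t ++ B) C) (out s) (inp (mrg h3)).
  by rewrite inp_mrg; split=> //=; [rewrite -!catA | right].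
move: (h2) (h4); rewrite !mgE => k2 k4; rewrite -(mgE k2) -(mgE k4).
move: k2 k4; rewrite -(mgE h1) -(mgE h3) => k2 k4.
exact/merge_eq/law_inp.
Qed.

End Laws.

(** * Composition along a single 1-cell *)

Section Dot.
Variable X : mergebicat.
Implicit Types (U V W t s r : cell2 X) (e f g k : cell1 X).
Implicit Types (I O N : seq (cell1 X)).

(** The composite used in rows.  The overlap is read off the boundaries, so that
    no 1-cell has to be supplied; it is the intended one when the last output of
    [U] is the first input of [V]. *)
Definition dot U V : cell2 X :=
  mg (Overlap (take (size (out U)).-1 (out U)) (take 1 (inp V)) [::] [::]
              (behead (inp V))) U V.

(** [U] enters along [e] on the left and leaves along [f] on the right, as a
    square or a row of squares does: these are the two 1-cells along which it
    is composed with its neighbours. *)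
Definition strip e I O f U := inp U = e :: I /\ out U = O ++ [:: f].

Lemma fits_dot e I O f I' O' g U V : strip e I O f U -> strip f I' O' g V ->
  fits (Overlap O [:: f] [::] [::] I') (out U) (inp V).
Proof. by move=> [_ ->] [-> _]; split=> //=; [left | right]. Qed.

Lemma dotE e I O f I' O' g U V : strip e I O f U -> strip f I' O' g V ->
  dot U V = mg (Overlap O [:: f] [::] [::] I') U V.
Proof.
move=> [_ oU] [iV _]; rewrite /dot oU iV size_cat addn1 /= take0.
by rewrite take_size_cat.
Qed.

Lemma dot_mrg O f I' U V
    (h : fits (Overlap O [:: f] [::] [::] I') (out U) (inp V)) :
  mrg h = dot U V.
Proof.
have [oU iV _ _ _] := h; rewrite mgE /dot oU iV /= size_cat addn1 /= take0.
by rewrite take_size_cat.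
Qed.

Lemma strip_dot e I O f I' O' g U V : strip e I O f U -> strip f I' O' g V ->
  strip e (I ++ I') (O ++ O') g (dot U V).
Proof.
move=> sU sV; rewrite (dotE sU sV) /strip.
have h := fits_dot sU sV; rewrite inp_mg // out_mg //=.
by case: sU sV => [-> _] [_ ->] /=; rewrite cats0 catA.
Qed.

Lemma dotA e I O f I' O' g I'' O'' k U V W :
  strip e I O f U -> strip f I' O' g V -> strip g I'' O'' k W ->
  dot (dot U V) W = dot U (dot V W).
Proof.
move=> sU sV sW; have sUV := strip_dot sU sV; have sVW := strip_dot sV sW.
rewrite (dotE sUV sW) (dotE sU sVW) (dotE sU sV) (dotE sV sW).
have h1 := fits_dot sU sV; have h3 := fits_dot sV sW.
have := @mg_assoc _ U V W O [::] [:: f] [::] [::] [::] I' O' [:: g] [::] [::] I''.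
by rewrite /= !cats0; apply; auto.
Qed.

(** The next four lemmas let a cell that is merged with one factor of a
    composite slide past the other factor.  When the cell is above the left
    factor, or below the right one, the three cells follow one another and the
    law is associativity; in the two other cases, two of the cells are merged
    with the same third one, and the law is interchange. *)
Lemma dot_pre_l e I I1 N I2 O f I' O' g U V s :
  strip e I O f U -> strip f I' O' g V -> I = I1 ++ N ++ I2 ->
  out s = N -> N <> [::] ->
  mg (Overlap [::] N [::] (e :: I1) (I2 ++ I')) s (dot U V) =
  dot (mg (Overlap [::] N [::] (e :: I1) I2) s U) V.
Proof.
move=> sU sV eI os nN.
have h : fits (Overlap [::] N [::] (e :: I1) I2) (out s) (inp U).
  by rewrite os sU.1 eI; split=> //=; [rewrite cats0 | right | right].
have sW : strip e (I1 ++ inp s ++ I2) O f (mg (Overlap [::] N [::] (e :: I1) I2) s U).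
  by split; rewrite ?inp_mg ?out_mg //= sU.2 cats0.
rewrite (dotE sU sV) (dotE sW sV).
have := @mg_assoc _ s U V [::] [::] N [::] [::] (e :: I1) I2 O [:: f] [::] [::] I'.
by rewrite /= !cats0 => ->; auto; apply: (fits_dot sU sV).
Qed.

Lemma dot_pre_r e I I1 N I2 O f I' O' g U V s :
  strip e I O f U -> strip f I' O' g V -> I' = I1 ++ N ++ I2 ->
  out s = N -> N <> [::] ->
  mg (Overlap [::] N [::] (e :: I ++ I1) I2) s (dot U V) =
  dot U (mg (Overlap [::] N [::] (f :: I1) I2) s V).
Proof.
move=> sU sV eI os nN.
have h : fits (Overlap [::] N [::] (f :: I1) I2) (out s) (inp V).
  by rewrite os sV.1 eI; split=> //=; [rewrite cats0 | right | right].
have sW : strip f (I1 ++ inp s ++ I2) O' g (mg (Overlap [::] N [::] (f :: I1) I2) s V).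
  by split; rewrite ?inp_mg ?out_mg //= sV.2 cats0.
rewrite (dotE sU sV) (dotE sU sW).
have := @mg_inp_inp _ U s V [::] [:: f] I1 N I2 O [::] [::] [::].
rewrite /= sU.1 => /(_ h).
have := fits_dot sU sV; rewrite eI => h' /(_ h') e'.
by rewrite -e'.
Qed.

Lemma dot_post_l e I O O1 N O2 f I' O' g U V r :
  strip e I O f U -> strip f I' O' g V -> O = O1 ++ N ++ O2 ->
  inp r = N -> N <> [::] ->
  mg (Overlap O1 N (O2 ++ O' ++ [:: g]) [::] [::]) (dot U V) r =
  dot (mg (Overlap O1 N (O2 ++ [:: f]) [::] [::]) U r) V.
Proof.
move=> sU sV eO ir nN.
have h : fits (Overlap O1 N (O2 ++ [:: f]) [::] [::]) (out U) (inp r).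
  by rewrite ir sU.2 eO; split=> //=; [rewrite -!catA | rewrite cats0 | left | left].
have sW : strip e I (O1 ++ out r ++ O2) f (mg (Overlap O1 N (O2 ++ [:: f]) [::] [::]) U r).
  by split; rewrite ?inp_mg ?out_mg //= -?catA // sU.1 cats0.
rewrite (dotE sU sV) (dotE sW sV).
have := @mg_out_out _ U r V O1 N O2 [:: f] [::] [::] [::] [::] I'.
rewrite /= ?cats0 sV.2 => /(_ h).
have := fits_dot sU sV; rewrite eO => h' /(_ h') e'.
by rewrite e'.
Qed.

Lemma dot_post_r e I O f I' O' O1 N O2 g U V r :
  strip e I O f U -> strip f I' O' g V -> O' = O1 ++ N ++ O2 ->
  inp r = N -> N <> [::] ->
  mg (Overlap (O ++ O1) N (O2 ++ [:: g]) [::] [::]) (dot U V) r =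
  dot U (mg (Overlap O1 N (O2 ++ [:: g]) [::] [::]) V r).
Proof.
move=> sU sV eO ir nN.
have h : fits (Overlap O1 N (O2 ++ [:: g]) [::] [::]) (out V) (inp r).
  by rewrite ir sV.2 eO; split=> //=; [rewrite -!catA | rewrite cats0 | left | left].
have sW : strip f I' (O1 ++ out r ++ O2) g (mg (Overlap O1 N (O2 ++ [:: g]) [::] [::]) V r).
  by split; rewrite ?inp_mg ?out_mg //= -?catA // sV.1 cats0.
rewrite (dotE sU sV) (dotE sU sW).
have := @mg_assoc _ U V r O [::] [:: f] [::] [::] [::] I' O1 N (O2 ++ [:: g]) [::] [::].
by rewrite /= !cats0 => ->; auto; apply: (fits_dot sU sV).
Qed.

End Dot.

(** * Rows of squares and naturality *)

(** Here [s0 x] is a 1-cell joining the images of [x] under [F] and [G], and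
    [s1 a] is a square filling the images of [a] and the 1-cells [s0] at its
    ends, as in a lax transformation.  A 2-cell is natural when its image can be
    moved through the row of squares.  The proofs that the
    two merges are defined are universally quantified, as in the relations of
    the Gray product; this form is also stable under reversing the 2-cells. *)
Definition row_natural (Z M : premerge) (F G : mergemor Z M)
    (s0 : cell0 Z -> cell1 M) (s1 : cell1 Z -> cell2 M) (p : cell2 Z) : Prop :=
  forall x x' t s
    (h : fits (Overlap [::] (map (mor1 G) (out p)) [::] [:: s0 x] [::])
              (out (mor2 G p)) (inp t))
    (h' : fits (Overlap [::] (map (mor1 F) (inp p)) [:: s0 x'] [::] [::])
              (out s) (inp (mor2 F p))),
  chain (@src Z) (@tgt Z) x (inp p) x' ->
  row (map s1 (out p)) t -> row (map s1 (inp p)) s -> mrg h = mrg h'.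

Definition col_natural (Z M : premerge) (F G : mergemor Z M)
    (s0 : cell0 Z -> cell1 M) (s1 : cell1 Z -> cell2 M) (p : cell2 Z) : Prop :=
  forall x x' t s
    (h : fits (Overlap [::] (map (mor1 F) (out p)) [::] [::] [:: s0 x'])
              (out (mor2 F p)) (inp t))
    (h' : fits (Overlap [:: s0 x] (map (mor1 G) (inp p)) [::] [::] [::])
              (out s) (inp (mor2 G p))),
  chain (@src Z) (@tgt Z) x (inp p) x' ->
  col (map s1 (out p)) t -> col (map s1 (inp p)) s -> mrg h = mrg h'.

Section RowOf.
Variable M : mergebicat.

(** The value [d] at the empty list is junk. *)
Fixpoint row_of (d : cell2 M) (l : seq (cell2 M)) : cell2 M :=
  if l is p :: l' then if l' is [::] then p else dot p (row_of d l') else d.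

Lemma row_ofP d l t : row l t -> t = row_of d l.
Proof.
elim=> {l t} [p|p l t e D I h H IH] //.
by rewrite dot_mrg IH; case: H.
Qed.

Lemma row_uniq (l : seq (cell2 M)) t t' : row l t -> row l t' -> t = t'.
Proof. by move=> /(row_ofP t) -> /(row_ofP t) ->. Qed.

End RowOf.

Section Row.
Variables (Z : premerge) (M : mergebicat) (F G : mergemor Z M).
Variables (s0 : cell0 Z -> cell1 M) (s1 : cell1 Z -> cell2 M).
Hypothesis inp_s1 : forall a, inp (s1 a) = [:: s0 (src a); mor1 G a].
Hypothesis out_s1 : forall a, out (s1 a) = [:: mor1 F a; s0 (tgt a)].

Local Notation ch := (chain (@src Z) (@tgt Z)).
Local Notation mF := (map (mor1 F)).
Local Notation mG := (map (mor1 G)).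

Definition squares d l : cell2 M := row_of d (map s1 l).

(** Prolonging [K] by a possibly empty row, on the left and on the right. *)
Definition dotl l K := foldr (fun a => dot (s1 a)) K l.

Definition dotr d K l := if l is [::] then K else dot K (squares d l).

Lemma strip_s1 a : strip (s0 (src a)) (mG [:: a]) (mF [:: a]) (s0 (tgt a)) (s1 a).
Proof. by split; rewrite ?inp_s1 ?out_s1. Qed.

Lemma strip_squares d x l x' : ch x l x' -> l <> [::] ->
  strip (s0 x) (mG l) (mF l) (s0 x') (squares d l).
Proof.
elim: l x => // a [|b l] IH x [<-] H _; first by rewrite -H; apply: strip_s1.
apply: (strip_dot (strip_s1 a)); exact: IH.
Qed.

Lemma strip_dotl x l y e I O k K : ch x l y -> e = s0 y -> strip e I O k K ->
  strip (s0 x) (mG l ++ I) (mF l ++ O) k (dotl l K).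
Proof.
move=> H -> sK; elim: l x H => [|a l IH] x /= => [->|[<- /IH]] //.
exact: (strip_dot (strip_s1 a)).
Qed.

Lemma strip_dotr d x l y e I O k K : ch x l y -> k = s0 x -> strip e I O k K ->
  strip e (I ++ mG l) (O ++ mF l) (s0 y) (dotr d K l).
Proof.
case: l => [|a l] H -> sK; first by rewrite !cats0 -H.
by apply: (strip_dot sK); apply: strip_squares.
Qed.

Lemma squares_cat d x l y l' z : ch x l y -> ch y l' z -> l <> [::] ->
  squares d (l ++ l') = dotr d (squares d l) l'.
Proof.
elim: l x => // a [|b l] IH x [_ H] H' _; first by case: l' {IH H'} => [|? ?].
have {}H : ch (tgt a) (b :: l) y := H.
rewrite -[LHS]/(dot (s1 a) (squares d ((b :: l) ++ l'))) (IH _ H) //.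
case: l' H' {IH} => // a' l' H'.
have nc (c : cell1 Z) m : c :: m <> [::] by [].
have := dotA (strip_s1 a) (strip_squares d H (nc _ _)) (strip_squares d H' (nc _ _)).
by move=> /esym.
Qed.

(** The middle segment of a row can be isolated, even when there is nothing to
    its left or to its right. *)
Lemma squares_cat3 d x l1 y l z l2 u :
  ch x l1 y -> ch y l z -> ch z l2 u -> l <> [::] ->
  squares d (l1 ++ l ++ l2) = dotl l1 (dotr d (squares d l) l2).
Proof.
move=> H1 H H2 nl; rewrite -(squares_cat d H H2 nl).
have nl2 : l ++ l2 <> [::] by case: l nl {H}.
elim: l1 x H1 => //= a l1 IH x [_ /IH <-].
by case: l1 {IH} => //=; case: (l ++ l2) nl2.
Qed.

Lemma row_squares d x l y : ch x l y -> l <> [::] ->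
  row (map s1 l) (squares d l).
Proof.
elim: l x => // a [|b l] IH x [_ H] _; first exact: row1.
have {}H : ch (tgt a) (b :: l) y := H.
have nc : b :: l <> [::] by [].
have sl := strip_squares d H nc.
rewrite -[squares _ _]/(dot (s1 a) (squares d (b :: l))) -(dot_mrg (fits_dot (strip_s1 a) sl)).
by apply: rowS; apply: IH H _.
Qed.

Lemma dotl_pre x l y e I1 N I2 O k K s :
  ch x l y -> e = s0 y -> strip e (I1 ++ N ++ I2) O k K -> out s = N -> N <> [::] ->
  mg (Overlap [::] N [::] (s0 x :: mG l ++ I1) I2) s (dotl l K) =
  dotl l (mg (Overlap [::] N [::] (s0 y :: I1) I2) s K).
Proof.
move=> H ey sK os nN; elim: l x H => [|a l IH] x /= => [->|[<- H]] //.
rewrite -(IH _ H).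
have sl := strip_dotl H ey sK.
apply: (dot_pre_r (strip_s1 a) sl) => //.
by rewrite -!catA.
Qed.

Lemma dotr_pre d x l y e I1 N I2 O k K s :
  ch x l y -> k = s0 x -> strip e (I1 ++ N ++ I2) O k K -> out s = N -> N <> [::] ->
  mg (Overlap [::] N [::] (e :: I1) (I2 ++ mG l)) s (dotr d K l) =
  dotr d (mg (Overlap [::] N [::] (e :: I1) I2) s K) l.
Proof.
case: l => [|a l] H -> sK os nN; first by rewrite cats0.
by apply: (dot_pre_l sK (strip_squares d H _)).
Qed.

Lemma dotl_post x l y e I O1 N O2 k K r :
  ch x l y -> e = s0 y -> strip e I (O1 ++ N ++ O2) k K -> inp r = N -> N <> [::] ->
  mg (Overlap (mF l ++ O1) N (O2 ++ [:: k]) [::] [::]) (dotl l K) r =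
  dotl l (mg (Overlap O1 N (O2 ++ [:: k]) [::] [::]) K r).
Proof.
move=> H ey sK os nN; elim: l x H => [|a l IH] x //= [_ H].
rewrite -(IH _ H).
have sl := strip_dotl H ey sK.
apply: (dot_post_r (strip_s1 a) sl) => //.
by rewrite -!catA.
Qed.

Lemma dotr_post d x l y e I O1 N O2 k K r :
  ch x l y -> k = s0 x -> strip e I (O1 ++ N ++ O2) k K -> inp r = N -> N <> [::] ->
  mg (Overlap O1 N (O2 ++ mF l ++ [:: s0 y]) [::] [::]) (dotr d K l) r =
  dotr d (mg (Overlap O1 N (O2 ++ [:: k]) [::] [::]) K r) l.
Proof.
case: l => [|a l] H -> sK os nN; first by rewrite -H.
by apply: (dot_post_l sK (strip_squares d H _)).
Qed.

Lemma squares_pre d x l1 y l z l2 u s :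
  ch x l1 y -> ch y l z -> ch z l2 u -> l <> [::] -> out s = mG l ->
  mg (Overlap [::] (mG l) [::] (s0 x :: mG l1) (mG l2)) s
     (squares d (l1 ++ l ++ l2)) =
  dotl l1 (dotr d (mg (Overlap [::] (mG l) [::] [:: s0 y] [::]) s (squares d l)) l2).
Proof.
move=> H1 H H2 nl os; rewrite (squares_cat3 d H1 H H2 nl).
have nG : mG l <> [::] by case: l nl {H os}.
have sl := strip_squares d H nl.
have sr := strip_dotr d H2 (erefl (s0 z)) sl.
have := dotl_pre (I1 := [::]) H1 erefl sr os nG; rewrite cats0 => ->.
have sl' : strip (s0 y) ([::] ++ mG l ++ [::]) (mF l) (s0 z) (squares d l).
  by rewrite cats0.
by rewrite (dotr_pre d H2 erefl sl').
Qed.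

Lemma squares_post d x l1 y l z l2 u r :
  ch x l1 y -> ch y l z -> ch z l2 u -> l <> [::] -> inp r = mF l ->
  mg (Overlap (mF l1) (mF l) (mF l2 ++ [:: s0 u]) [::] [::])
     (squares d (l1 ++ l ++ l2)) r =
  dotl l1 (dotr d (mg (Overlap [::] (mF l) [:: s0 z] [::] [::]) (squares d l) r) l2).
Proof.
move=> H1 H H2 nl ir; rewrite (squares_cat3 d H1 H H2 nl).
have nF : mF l <> [::] by case: l nl {H ir}.
have sl := strip_squares d H nl.
have sr := strip_dotr d H2 (erefl (s0 z)) sl.
have := dotl_post (O1 := [::]) H1 erefl sr ir nF; rewrite cats0 => ->.
have sl' : strip (s0 y) (mG l) ([::] ++ mF l ++ [::]) (s0 z) (squares d l).
  by rewrite cats0.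
by rewrite (dotr_post d H2 erefl sl').
Qed.

Lemma fits_squares_pre d x l1 y l z l2 u s :
  ch x l1 y -> ch y l z -> ch z l2 u -> l <> [::] -> out s = mG l ->
  fits (Overlap [::] (mG l) [::] (s0 x :: mG l1) (mG l2)) (out s)
     (inp (squares d (l1 ++ l ++ l2))).
Proof.
move=> H1 H H2 nl os.
have [|-> _] := @strip_squares d x (l1 ++ l ++ l2) u _ (cat_neq0 (a:=l1) (b:=l2) nl).
  by apply/chain_cat; exists y; split=> //; apply/chain_cat; exists z.
split=> /=; rewrite ?os ?cats0 ?map_cat //; try by right.
by case: l nl {H os}.
Qed.

Lemma fits_squares_post d x l1 y l z l2 u r :
  ch x l1 y -> ch y l z -> ch z l2 u -> l <> [::] -> inp r = mF l ->
  fits (Overlap (mF l1) (mF l) (mF l2 ++ [:: s0 u]) [::] [::])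
     (out (squares d (l1 ++ l ++ l2))) (inp r).
Proof.
move=> H1 H H2 nl ir.
have [|_ ->] := @strip_squares d x (l1 ++ l ++ l2) u _ (cat_neq0 (a:=l1) (b:=l2) nl).
  by apply/chain_cat; exists y; split=> //; apply/chain_cat; exists z.
split=> /=; rewrite ?ir ?cats0 ?map_cat -?catA //; try by left.
by case: l nl {H ir}.
Qed.

(** A natural cell moves through any longer row: only the squares of the segment
    [out p], respectively [inp p], are affected. *)
Lemma row_natural_whisker d p x l1 y z l2 u :
  row_natural F G s0 s1 p -> ch x l1 y -> ch y (inp p) z -> ch z l2 u ->
  mg (Overlap [::] (mG (out p)) [::] (s0 x :: mG l1) (mG l2)) (mor2 G p)
     (squares d (l1 ++ out p ++ l2)) =
  mg (Overlap (mF l1) (mF (inp p)) (mF l2 ++ [:: s0 u]) [::] [::])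
     (squares d (l1 ++ inp p ++ l2)) (mor2 F p).
Proof.
move=> np H1 H H2; have Ho := chain_out H.
have ni := @inp_neq0 _ p; have no := @out_neq0 _ p.
rewrite (squares_pre d H1 Ho H2) ?mor_out // (squares_post d H1 H H2) ?mor_inp //.
have h : fits (Overlap [::] (mG (out p)) [::] [:: s0 y] [::])
              (out (mor2 G p)) (inp (squares d (out p))).
  have := @fits_squares_pre d y [::] y (out p) z [::] z (mor2 G p) erefl Ho erefl no.
  by rewrite cats0; apply; rewrite mor_out.
have h' : fits (Overlap [::] (mF (inp p)) [:: s0 z] [::] [::])
              (out (squares d (inp p))) (inp (mor2 F p)).
  have := @fits_squares_post d y [::] y (inp p) z [::] z (mor2 F p) erefl H erefl ni.
  by rewrite cats0; apply; rewrite mor_inp.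
rewrite -(mgE h) -(mgE h').
by rewrite (np _ _ _ _ h h' H (row_squares d Ho no) (row_squares d H ni)).
Qed.

(** Write the merge as [p] above [q].  By associativity [q] meets the row first,
    and it moves through with the outputs of [p] that avoid [q] as passive
    segments; then [p] moves through, with the inputs of [q] that avoid [p] as
    passive segments.  The row between the two steps is the same, because on
    each side of the shared part one of these two passive segments is empty. *)
Lemma row_natural_mrg p q w (hw : fits w (out p) (inp q)) :
  row_natural F G s0 s1 p -> row_natural F G s0 s1 q ->
  row_natural F G s0 s1 (mrg hw).
Proof.
move=> np nq x x' t s h h' Hr /(row_ofP (mor2 F p)) et /(row_ofP (mor2 F p)) es; subst t s.
have [/= ep eq nL al ar] := hw; have [/= ipq opq] := (inp_mrg hw, out_mrg hw).
move: Hr h h'; rewrite ipq opq.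
move=> /chain_cat [u [HG1 /chain_cat [v [HA HG2]]]] h h'.
have Hp := chain_out HA.
move: (Hp); rewrite {1}ep.
move=> /chain_cat [u' [HD1 /chain_cat [v' [HL HD2]]]].
(* The 0-cells where [q] starts and ends, inside the row. *)
have [e [He1 He2]] : exists e, ch x (out_l w) e /\ ch e (inp_l w) u'.
  case: al HG1 HD1 => -> /= HG HD; last by exists x; rewrite HD in HG.
  by exists u'; rewrite HG.
have [e' [He'1 He'2]] : exists e, ch v' (inp_r w) e /\ ch e (out_r w) x'.
  case: ar HG2 HD2 => -> /= HG HD; last by exists x'; rewrite HD.
  by exists v'; rewrite -HG.
have Hq : ch e (inp q) e'.
  by rewrite eq; apply/chain_cat; exists u'; split=> //; apply/chain_cat; exists v'.
have wq := row_natural_whisker (mor2 F p) nq He1 Hq He'2.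
have wp := row_natural_whisker (mor2 F p) np HG1 HA HG2.
rewrite (mgE h) (mgE h') !mor_mrg !(mgE (fits_mor _ hw)) /= {h h'}.
set d := mor2 F p in wp wq *.
(* The row between [q] and [p], seen from [q] and from [p]. *)
have eswap : out_l w ++ inp q ++ out_r w = inp_l w ++ out p ++ inp_r w.
  rewrite ep eq; case: al => ->; case: ar => ->; by rewrite /= ?cats0 -?catA.
rewrite eswap in wq.
have fG := fits_mor G hw; have fF := fits_mor F hw.
have oq : out q <> [::] := @out_neq0 _ q.
have Hqo := chain_out Hq.
have fq := @fits_squares_pre d x _ e _ e' _ x' (mor2 G q) He1 Hqo He'2 oq (mor_out G q).
have fp := @fits_squares_post d x _ u _ v _ x' (mor2 F p) HG1 HA HG2 (@inp_neq0 _ p) (mor_inp F p).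
have fp' := @fits_squares_pre d x _ u _ v _ x' (mor2 G p) HG1 Hp HG2 (@out_neq0 _ p) (mor_out G p).
have fq' := @fits_squares_post d x _ e _ e' _ x' (mor2 F q) He1 Hq He'2 (@inp_neq0 _ q) (mor_inp F q).
rewrite eswap in fq'.
(* Group [q] with the row below it, then [p] with the row below it, and finally
   the images of [p] and [q] under [F]. *)
have a1 := @mg_assoc _ (mor2 G p) (mor2 G q) (squares d (out_l w ++ out q ++ out_r w))
  [::] (mG (out_l w)) (mG (shared w)) (mG (out_r w)) [::] (mG (inp_l w)) (mG (inp_r w))
  [::] (mG (out q)) [::] [:: s0 x] [::].
have a2 := @mg_assoc _ (mor2 G p) (squares d (inp_l w ++ out p ++ inp_r w)) (mor2 F q)
  [::] [::] (mG (out p)) [::] [::] (s0 x :: mG (inp_l w)) (mG (inp_r w))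
  (mF (out_l w)) (mF (inp q)) (mF (out_r w) ++ [:: s0 x']) [::] [::].
have a3 := @mg_assoc _ (squares d (inp_l w ++ inp p ++ inp_r w)) (mor2 F p) (mor2 F q)
  [::] (mF (inp_l w)) (mF (inp p)) (mF (inp_r w)) [:: s0 x'] [::] [::]
  (mF (out_l w)) (mF (shared w)) (mF (out_r w)) [::] [::].
rewrite /= ?cats0 -?map_cat -?ep -?eq in a1 a2 a3.
rewrite /map_overlap in fG fF *.
rewrite a1; auto; rewrite wq -a2; auto; rewrite wp a3; auto.
Qed.

End Row.

(** * Reversing 2-cells *)

(** Exchanging inputs and outputs exchanges columns and rows, and preserves the
    laws of merging. *)
Definition flip (A : Type) (w : overlap A) : overlap A :=
  Overlap (inp_l w) (shared w) (inp_r w) (out_l w) (out_r w).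

Lemma fits_flip (A : Type) (w : overlap A) o i : fits w o i -> fits (flip w) i o.
Proof. by case=> -> -> nL cl cr; split=> //=; [case: cl | case: cr]; auto. Qed.

Definition co_poly (P : polygraph) : polygraph :=
  @Polygraph (cell0 P) (cell1 P) (cell2 P) (@src P) (@tgt P) (@out P) (@inp P)
    (@out_neq0 P) (@inp_neq0 P)
    (fun p => let: ex_intro x (ex_intro y (conj i o)) := globular p in
      ex_intro _ x (ex_intro _ y (conj o i))).

Definition co_pre (X : premerge) : premerge :=
  @PreMerge (co_poly X) (fun t s w h => @mrg X s t (flip w) (fits_flip h))
    (fun _ _ _ _ => out_mrg _) (fun _ _ _ _ => inp_mrg _).

Lemma co_merge_eq (X : mergebicat) (u v : cell2 (co_pre X)) :
  merge_law u v -> u = v.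
Proof.
case=> {u v} t s r *; rewrite [LHS]/= [RHS]/=; symmetry; apply/(@merge_eq X).
- exact: law_assoc.
- exact: law_inp.
- exact: law_out.
Qed.

Definition co (X : mergebicat) : mergebicat := MergeBicat (@co_merge_eq X).

Section CoMorphism.
Variables (X Y : premerge) (f : mergemor X Y).

Definition co_mor_poly : polymor (co_pre X) (co_pre Y) :=
  @PolyMor (co_poly X) (co_poly Y) (mor0 f) (mor1 f) (mor2 f)
    (mor_src f) (mor_tgt f) (mor_out f) (mor_inp f).

Lemma co_mor_mrg (t s : cell2 (co_pre X)) w (h : fits w (out t) (inp s)) :
  mor2 co_mor_poly (mrg h) = mrg (fits_mor co_mor_poly h).
Proof. by rewrite [LHS]mor_mrg; apply: (@mrg_ext Y). Qed.

Definition co_mor : mergemor (co_pre X) (co_pre Y) := MergeMor co_mor_mrg.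

End CoMorphism.

Lemma co_col (X : premerge) (l : seq (cell2 X)) t :
  @col X l t <-> @row (co_pre X) l t.
Proof.
split; elim=> {l t} [p|p l t e D I h _ IH]; [exact: row1| |exact: col1|].
  have -> : mrg h = @mrg (co_pre X) _ _ _ (fits_flip h) by apply: mrg_ext.
  exact: rowS.
exact: (@colS X _ _ _ _ _ _ (fits_flip h)).
Qed.

Lemma col_uniq (M : mergebicat) (l : seq (cell2 M)) t t' :
  col l t -> col l t' -> t = t'.
Proof. by move=> /co_col Ht /co_col Ht'; apply: (@row_uniq (co M) l). Qed.

Lemma co_natural (Z : premerge) (M : mergebicat) (F G : mergemor Z M) s0 s1 p :
  col_natural F G s0 s1 p <->
  @row_natural (co_pre Z) (co M) (co_mor F) (co_mor G) s0 s1 p.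
Proof.
split=> n x x' t s h h' H /co_col Ht /co_col Hs.
  exact/esym/(n _ _ _ _ (fits_flip h') (fits_flip h) (@chain_out (co_pre Z) p _ _ H) Hs Ht).
have e := n _ _ _ _ (fits_flip h') (fits_flip h) (chain_out H) Hs Ht.
by apply: esym; apply: (etrans _ (etrans e _)); apply: (@mrg_ext M).
Qed.

Section Col.
Variables (Z : premerge) (M : mergebicat) (F G : mergemor Z M).
Variables (s0 : cell0 Z -> cell1 M) (s1 : cell1 Z -> cell2 M).
Hypothesis inp_s1 : forall a, inp (s1 a) = [:: mor1 F a; s0 (tgt a)].
Hypothesis out_s1 : forall a, out (s1 a) = [:: s0 (src a); mor1 G a].

Lemma col_natural_mrg p q w (hw : fits w (out p) (inp q)) :
  col_natural F G s0 s1 p -> col_natural F G s0 s1 q ->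
  col_natural F G s0 s1 (mrg hw).
Proof.
move=> /co_natural np /co_natural nq; apply/co_natural.
have -> : mrg hw = @mrg (co_pre Z) _ _ _ (fits_flip hw).
  by apply: (@mrg_ext Z) => //; case: (w).
exact: (@row_natural_mrg (co_pre Z) (co M) (co_mor F) (co_mor G) s0 s1 out_s1 inp_s1
  q p (flip w) (fits_flip hw) nq np).
Qed.

End Col.

(** * Transporting naturality along morphisms *)

(** Forms of naturality in which boundaries only have to match up to a provable
    equation. *)
Lemma row_naturalE (Z M : premerge) (F G : mergemor Z M) s0 s1 p :
  row_natural F G s0 s1 p -> forall x x' t s u v w w'
    (h : fits w (out u) (inp t)) (h' : fits w' (out s) (inp v)),
  u = mor2 G p -> v = mor2 F p ->
  w = Overlap [::] (map (mor1 G) (out p)) [::] [:: s0 x] [::] ->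
  w' = Overlap [::] (map (mor1 F) (inp p)) [:: s0 x'] [::] [::] ->
  chain (@src Z) (@tgt Z) x (inp p) x' ->
  row (map s1 (out p)) t -> row (map s1 (inp p)) s -> mrg h = mrg h'.
Proof. by move=> n x x' t s u v w w' h h' eu ev ew ew'; subst; apply: n. Qed.

Lemma col_naturalE (Z M : premerge) (F G : mergemor Z M) s0 s1 p :
  col_natural F G s0 s1 p -> forall x x' t s u v w w'
    (h : fits w (out u) (inp t)) (h' : fits w' (out s) (inp v)),
  u = mor2 F p -> v = mor2 G p ->
  w = Overlap [::] (map (mor1 F) (out p)) [::] [::] [:: s0 x'] ->
  w' = Overlap [:: s0 x] (map (mor1 G) (inp p)) [::] [::] [::] ->
  chain (@src Z) (@tgt Z) x (inp p) x' ->
  col (map s1 (out p)) t -> col (map s1 (inp p)) s -> mrg h = mrg h'.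
Proof. by move=> n x x' t s u v w w' h h' eu ev ew ew'; subst; apply: n. Qed.

Section Transport.
Variables (Z : premerge) (M : mergebicat) (F G : mergemor Z M).
Variables (s0 : cell0 Z -> cell1 M) (s1 : cell1 Z -> cell2 M).

Lemma row_natural_comp (Z' : premerge) (k : mergemor Z' Z) p :
  row_natural F G s0 s1 (mor2 k p) <->
  row_natural (mergemor_comp F k) (mergemor_comp G k) (s0 \o mor0 k) (s1 \o mor1 k) p.
Proof.
have rowk l t : row (map s1 (map (mor1 k) l)) t <-> row (map (s1 \o mor1 k) l) t.
  by rewrite -map_comp.
split=> n x x' t s h h' H.
  move=> /rowk Ht /rowk Hs.
  apply: (row_naturalE n (x := mor0 k x) (x' := mor0 k x'));
    rewrite ?mor_inp ?mor_out -?map_comp //.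
  - exact: mor_chain H.
  - exact/rowk.
  - exact/rowk.
move=> Ht Hs; rewrite mor_out in Ht; rewrite mor_inp in Hs.
move/rowk: Ht => Ht; move/rowk: Hs => Hs.
have [y [y' [Hy _]]] := globular p.
have ek := mor_chain k Hy; rewrite -mor_inp in ek.
have [ex ex'] := chain_fun H ek (@inp_neq0 _ _); subst x x'.
by apply: (row_naturalE n) Hy Ht Hs; rewrite ?mor_inp ?mor_out -?map_comp.
Qed.

Hypothesis inp_s1 : forall a, inp (s1 a) = [:: s0 (src a); mor1 G a].
Hypothesis out_s1 : forall a, out (s1 a) = [:: mor1 F a; s0 (tgt a)].

Lemma row_natural_image (M' : mergebicat) (k : mergemor M M') p :
  row_natural F G s0 s1 p ->
  row_natural (mergemor_comp k F) (mergemor_comp k G) (mor1 k \o s0) (mor2 k \o s1) p.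
Proof.
move=> n x x' t s h h' H Ht Hs; set d := mor2 F p.
have Ho := chain_out H; have no := @out_neq0 _ p; have ni := @inp_neq0 _ p.
have rt := row_squares inp_s1 out_s1 d Ho no.
have rs := row_squares inp_s1 out_s1 d H ni.
have uniq l u v : row (map (mor2 k \o s1) l) u -> row (map s1 l) v -> u = mor2 k v.
  by move=> r /(mor_row k); rewrite -map_comp => /(row_uniq r).
have et := uniq _ _ _ Ht rt; have es := uniq _ _ _ Hs rs; subst t s.
have h0 := @fits_squares_pre _ _ _ _ _ _ inp_s1 out_s1 d x [::] x (out p) x' [::] x'
  (mor2 G p) erefl Ho erefl no (mor_out G p).
have h0' := @fits_squares_post _ _ _ _ _ _ inp_s1 out_s1 d x [::] x (inp p) x' [::] x'
  (mor2 F p) erefl H erefl ni (mor_inp F p).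
rewrite !cats0 /= in h0 h0' rt rs *.
have e := n _ _ _ _ h0 h0' H rt rs.
have -> : mrg h = mor2 k (mrg h0).
  by rewrite mor_mrg; apply: mrg_ext => //=; rewrite /map_overlap /= -map_comp.
by rewrite e mor_mrg; apply: mrg_ext => //=; rewrite /map_overlap /= -map_comp.
Qed.

End Transport.

Section TransportCol.
Variables (Z : premerge) (M : mergebicat) (F G : mergemor Z M).
Variables (s0 : cell0 Z -> cell1 M) (s1 : cell1 Z -> cell2 M).

Lemma col_natural_comp (Z' : premerge) (k : mergemor Z' Z) p :
  col_natural F G s0 s1 (mor2 k p) <->
  col_natural (mergemor_comp F k) (mergemor_comp G k) (s0 \o mor0 k) (s1 \o mor1 k) p.
Proof.
split=> /co_natural n; apply/co_natural.
  exact: (@row_natural_comp _ (co M) (co_mor F) (co_mor G) _ _ _ (co_mor k) p).1 n.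
exact: (@row_natural_comp _ (co M) (co_mor F) (co_mor G) s0 s1 _ (co_mor k) p).2 n.
Qed.

Hypothesis inp_s1 : forall a, inp (s1 a) = [:: mor1 F a; s0 (tgt a)].
Hypothesis out_s1 : forall a, out (s1 a) = [:: s0 (src a); mor1 G a].

Lemma col_natural_image (M' : mergebicat) (k : mergemor M M') p :
  col_natural F G s0 s1 p ->
  col_natural (mergemor_comp k F) (mergemor_comp k G) (mor1 k \o s0) (mor2 k \o s1) p.
Proof.
move=> /co_natural n; apply/co_natural.
exact: (@row_natural_image (co_pre Z) (co M) (co_mor F) (co_mor G) s0 s1 out_s1 inp_s1
  (co M') (co_mor k) p n).
Qed.

End TransportCol.

(** * The universal property of the Gray product *)

Section GrayStructure.
Variables X Y : mergebicat.

Lemma gray_cell2_inp (u : gray_gen X Y) : inp (gray_cell2 u) = gray_inp u.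
Proof. exact: (quot_inp (gray_par (Y:=Y))). Qed.

Lemma gray_cell2_out (u : gray_gen X Y) : out (gray_cell2 u) = gray_out u.
Proof. exact: (quot_out (gray_par (Y:=Y))). Qed.

Lemma gray_proj_mrg (t s : cell2 (free (gray_poly X Y))) w
    (h : fits w (out t) (inp s)) :
  qpi (gray_eq (Y:=Y)) (mrg h) =
  @mrg (gray X Y) _ _ _ (fits_qpi (gray_par (Y:=Y)) h).
Proof. exact: qpi_mrg. Qed.

Definition gray_inl_poly y : polymor X (gray X Y) :=
  @PolyMor X (gray X Y) (fun x => (x, y)) (fun a => G10 a y)
    (fun p => gray_cell2 (G20 p y)) (fun _ => erefl) (fun _ => erefl)
    (fun p => gray_cell2_inp (G20 p y)) (fun p => gray_cell2_out (G20 p y)).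

Definition gray_inr_poly x : polymor Y (gray X Y) :=
  @PolyMor Y (gray X Y) (fun y => (x, y)) (fun b => G01 x b)
    (fun p => gray_cell2 (G02 x p)) (fun _ => erefl) (fun _ => erefl)
    (fun p => gray_cell2_inp (G02 x p)) (fun p => gray_cell2_out (G02 x p)).

Lemma gray_inl_mrg y (t s : cell2 X) w (h : fits w (out t) (inp s)) :
  mor2 (gray_inl_poly y) (mrg h) = mrg (fits_mor (gray_inl_poly y) h).
Proof.
have h' : fits (map_overlap (fun a => G10 a y) w)
    (out (@gen (gray_poly X Y) (G20 t y))) (inp (@gen (gray_poly X Y) (G20 s y))).
  exact: (fits_map (fun a => G10 a y) h).
rewrite [LHS](_ : _ = qpi (gray_eq (Y:=Y)) (@mrg (free (gray_poly X Y)) _ _ _ h')).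
  by rewrite (gray_proj_mrg h'); apply: (@mrg_ext (gray X Y)).
by apply/qpiP/cong_eqn; apply: gray_eq1r.
Qed.

Lemma gray_inr_mrg x (t s : cell2 Y) w (h : fits w (out t) (inp s)) :
  mor2 (gray_inr_poly x) (mrg h) = mrg (fits_mor (gray_inr_poly x) h).
Proof.
have h' : fits (map_overlap (G01 x) w)
    (out (@gen (gray_poly X Y) (G02 x t))) (inp (@gen (gray_poly X Y) (G02 x s))).
  exact: (fits_map (G01 x) h).
rewrite [LHS](_ : _ = qpi (gray_eq (Y:=Y)) (@mrg (free (gray_poly X Y)) _ _ _ h')).
  by rewrite (gray_proj_mrg h'); apply: (@mrg_ext (gray X Y)).
by apply/qpiP/cong_eqn; apply: gray_eq1l.
Qed.

Definition gray_inl y : mergemor X (gray X Y) := MergeMor (@gray_inl_mrg y).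
Definition gray_inr x : mergemor Y (gray X Y) := MergeMor (@gray_inr_mrg x).

Definition gray_sq (a : cell1 X) (b : cell1 Y) : cell2 (gray X Y) :=
  gray_cell2 (G11 a b).

(** Every 2-cell of the quotient is the class of a formal merge of
    generators. *)
Lemma gray_ind (P : cell2 (gray X Y) -> Prop) :
  (forall u, P (gray_cell2 u)) ->
  (forall t s w (h : fits w (out t) (inp s)), P t -> P s -> P (mrg h)) ->
  forall q, P q.
Proof.
move=> Pg Pm q; rewrite -(qreprK q); case: (qrepr q) => i o c.
elim: c => {i o} [u|i o i' o' t Pt s Ps w h]; first exact: Pg.
pose T := free (gray_poly X Y).
pose h' : fits w (@out T (FTerm t)) (@inp T (FTerm s)) := h.
have := gray_proj_mrg h'; rewrite /= -/T => ->; exact: Pm.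
Qed.

Lemma gray_ext (M : premerge) (f g : mergemor (gray X Y) M) :
  mor0 f =1 mor0 g -> mor1 f =1 mor1 g ->
  (forall u, mor2 f (gray_cell2 u) = mor2 g (gray_cell2 u)) -> f = g.
Proof.
move=> e0 e1 e2; apply: mergemor_ext => //; apply: gray_ind => // t s w h et es.
by rewrite !mor_mrg; apply: mrg_ext => //; rewrite (funext e1).
Qed.

Lemma gray_hom_ext (M : premerge) (f g : mergemor (gray X Y) M) :
  (forall y, mergemor_comp f (gray_inl y) = mergemor_comp g (gray_inl y)) ->
  (forall x, mergemor_comp f (gray_inr x) = mergemor_comp g (gray_inr x)) ->
  (forall a b, mor2 f (gray_sq a b) = mor2 g (gray_sq a b)) -> f = g.
Proof.
move=> el er es; apply: gray_ext => [[x y]|[x b|a y]|[x p|p y|a b]] //.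
- exact: (congr1 (fun k : mergemor _ _ => mor0 k x) (el y)).
- exact: (congr1 (fun k : mergemor _ _ => mor1 k b) (er x)).
- exact: (congr1 (fun k : mergemor _ _ => mor1 k a) (el y)).
- exact: (congr1 (fun k : mergemor _ _ => mor2 k p) (er x)).
- exact: (congr1 (fun k : mergemor _ _ => mor2 k p) (el y)).
- exact: es.
Qed.

Lemma row_proj l t : @row (free (gray_poly X Y)) l t ->
  @row (gray X Y) (map (qpi (gray_eq (Y:=Y))) l) (qpi (gray_eq (Y:=Y)) t).
Proof.
elim=> {l t} [p|p l t e D I h _ IH]; first exact: row1.
by rewrite gray_proj_mrg; apply: (rowS (X := gray X Y)).
Qed.

Lemma col_proj l t : @col (free (gray_poly X Y)) l t ->
  @col (gray X Y) (map (qpi (gray_eq (Y:=Y))) l) (qpi (gray_eq (Y:=Y)) t).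
Proof.
elim=> {l t} [p|p l t e D I h _ IH]; first exact: col1.
by rewrite gray_proj_mrg; apply: (colS (X := gray X Y)).
Qed.

(** The relations [gray_eq3] and [gray_eq2], restated in the quotient.  A row or
    a column in the quotient is the class of a formal one, because the squares
    determine their composite. *)
Lemma gray_row_natural (c : cell1 Y) p :
  row_natural (gray_inl (src c)) (gray_inl (tgt c)) (fun x => G01 x c)
    (fun a => gray_sq a c) p.
Proof.
move=> x x' t s h h' H Ht Hs.
have [t0 Ht0] := row_square c (@out_neq0 _ p) (chain_out H).
have [s0 Hs0] := row_square c (@inp_neq0 _ p) H.
have et : t = qpi (gray_eq (Y:=Y)) t0.
  by apply: row_uniq Ht _; have := row_proj Ht0; rewrite -map_comp.
have es : s = qpi (gray_eq (Y:=Y)) s0.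
  by apply: row_uniq Hs _; have := row_proj Hs0; rewrite -map_comp.
subst t s.
have [k ->] := quot_mrgE h; have [k' ->] := quot_mrgE h'.
by apply/qpiP/cong_eqn; apply: gray_eq3 Ht0 Hs0.
Qed.

Lemma gray_col_natural (c : cell1 X) p :
  col_natural (gray_inr (src c)) (gray_inr (tgt c)) (G10 c) (gray_sq c) p.
Proof.
move=> x x' t s h h' H Ht Hs.
have [t0 Ht0] := col_square c (@out_neq0 _ p) (chain_out H).
have [s0 Hs0] := col_square c (@inp_neq0 _ p) H.
have et : t = qpi (gray_eq (Y:=Y)) t0.
  by apply: col_uniq Ht _; have := col_proj Ht0; rewrite -map_comp.
have es : s = qpi (gray_eq (Y:=Y)) s0.
  by apply: col_uniq Hs _; have := col_proj Hs0; rewrite -map_comp.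
subst t s.
have [k ->] := quot_mrgE h; have [k' ->] := quot_mrgE h'.
by apply/qpiP/cong_eqn; apply: gray_eq2 Ht0 Hs0.
Qed.

End GrayStructure.

Lemma gray_sq_inp (X Y : mergebicat) (a : cell1 X) (b : cell1 Y) :
  inp (gray_sq a b) = [:: G01 (src a) b; G10 a (tgt b)].
Proof. exact: gray_cell2_inp. Qed.

Lemma gray_sq_out (X Y : mergebicat) (a : cell1 X) (b : cell1 Y) :
  out (gray_sq a b) = [:: G10 a (src b); G01 (tgt a) b].
Proof. exact: gray_cell2_out. Qed.

Lemma gray_sq_bdry (X Y : mergebicat) (a : cell1 X) (b : cell1 Y) :
  inp (gray_sq a b) = [:: G01 (src a) b; G10 a (tgt b)] /\
  out (gray_sq a b) = [:: G10 a (src b); G01 (tgt a) b].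
Proof. by rewrite gray_sq_inp gray_sq_out. Qed.

Lemma mor_sq_bdry (X Y M : mergebicat) (k : mergemor (gray X Y) M)
    (a : cell1 X) (b : cell1 Y) :
  inp (mor2 k (gray_sq a b)) = [:: mor1 k (G01 (src a) b); mor1 k (G10 a (tgt b))] /\
  out (mor2 k (gray_sq a b)) = [:: mor1 k (G10 a (src b)); mor1 k (G01 (tgt a) b)].
Proof. by rewrite mor_inp mor_out gray_sq_inp gray_sq_out. Qed.

Arguments gray_row_natural {X Y} c p.
Arguments gray_col_natural {X Y} c p.

Section QuotientLift.
Variables (X : premerge) (E : cell2 X -> cell2 X -> Prop).
Hypothesis E_par : forall t s, E t s -> inp t = inp s /\ out t = out s.
Variables (M : mergebicat) (f : mergemor X M).
Hypothesis fE : forall t s, E t s -> mor2 f t = mor2 f s.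

Lemma cong_lift t s : cong E t s -> mor2 f t = mor2 f s.
Proof.
elim=> {t s} // [t s r _ -> _ ->|t t' s s' w h h' _ e _ e'|t s] //.
  by rewrite !mor_mrg; apply: mrg_ext.
by move=> /(mor_merge_law f); apply: merge_eq.
Qed.

Definition quot_lift_poly : polymor (quot E_par) M :=
  @PolyMor (quot E_par) M (mor0 f) (mor1 f) (fun q => mor2 f (qrepr q))
    (mor_src f) (mor_tgt f) (fun q => mor_inp f (qrepr q))
    (fun q => mor_out f (qrepr q)).

Lemma quot_lift_mrg (t s : cell2 (quot E_par)) w (h : fits w (out t) (inp s)) :
  mor2 quot_lift_poly (mrg h) = mrg (fits_mor quot_lift_poly h).
Proof.
rewrite [LHS](cong_lift (qrepr_cong E _)) mor_mrg; exact: mrg_ext.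
Qed.

Definition quot_lift : mergemor (quot E_par) M := MergeMor quot_lift_mrg.

Lemma quot_liftE t : mor2 quot_lift (qpi E t) = mor2 f t.
Proof. exact: cong_lift (qrepr_cong E t). Qed.

End QuotientLift.

Section GrayLift.
Variables (X Y M : mergebicat).
Variables (L : cell0 Y -> mergemor X M) (R : cell0 X -> mergemor Y M).
Variable S : cell1 X -> cell1 Y -> cell2 M.
Hypothesis LR : forall x y, mor0 (L y) x = mor0 (R x) y.
Hypothesis S_inp : forall a b,
  inp (S a b) = [:: mor1 (R (src a)) b; mor1 (L (tgt b)) a].
Hypothesis S_out : forall a b,
  out (S a b) = [:: mor1 (L (src b)) a; mor1 (R (tgt a)) b].
Hypothesis S_row : forall c p, row_natural (L (src c)) (L (tgt c))
  (fun x => mor1 (R x) c) (fun a => S a c) p.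
Hypothesis S_col : forall c p, col_natural (R (src c)) (R (tgt c))
  (fun y => mor1 (L y) c) (S c) p.

Definition gray_lift0 (u : cell0 X * cell0 Y) : cell0 M := mor0 (L u.2) u.1.

Definition gray_lift1 (u : gray_cell1 X Y) : cell1 M :=
  match u with G01 x b => mor1 (R x) b | G10 a y => mor1 (L y) a end.

Definition gray_lift2 (u : gray_gen X Y) : cell2 M :=
  match u with
  | G02 x p => mor2 (R x) p | G20 p y => mor2 (L y) p | G11 a b => S a b
  end.

Definition gray_lift_poly : polymor (gray_poly X Y) M.
Proof.
exists gray_lift0 gray_lift1 gray_lift2.
- by case=> [x b|a y] /=; rewrite mor_src // -LR.
- by case=> [x b|a y] /=; rewrite mor_tgt // -LR.
- by case=> [x p|p y|a b] /=; rewrite ?mor_inp ?S_inp // -!map_comp.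
- by case=> [x p|p y|a b] /=; rewrite ?mor_out ?S_out // -!map_comp.
Defined.

Lemma gray_lift_eq t s : gray_eq t s ->
  mor2 (free_lift gray_lift_poly) t = mor2 (free_lift gray_lift_poly) s.
Proof.
pose H := free_lift gray_lift_poly.
case=> {t s}.
- move=> x p q w h h'.
  have [k' ->] := mor_mrg_eq H h' erefl erefl.
  rewrite [LHS](mor_mrg (R x) h); apply: mrg_ext => //.
  by rewrite -map_overlap_comp.
- move=> y p q w h h'.
  have [k' ->] := mor_mrg_eq H h' erefl erefl.
  rewrite [LHS](mor_mrg (L y) h); apply: mrg_ext => //.
  by rewrite -map_overlap_comp.
- move=> c p y y' t s h h' Hc Ht Hs.
  have [k ->] := mor_mrg_eq H h erefl erefl.
  have [k' ->] := mor_mrg_eq H h' erefl erefl.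
  apply: (col_naturalE (@S_col c p)) Hc _ _ => //.
  + by rewrite /map_overlap /= -map_comp.
  + by rewrite /map_overlap /= -map_comp.
  + by have := mor_col H Ht; rewrite -map_comp.
  + by have := mor_col H Hs; rewrite -map_comp.
- move=> c p y y' t s h h' Hc Ht Hs.
  have [k ->] := mor_mrg_eq H h erefl erefl.
  have [k' ->] := mor_mrg_eq H h' erefl erefl.
  apply: (row_naturalE (@S_row c p)) Hc _ _ => //.
  + by rewrite /map_overlap /= -map_comp.
  + by rewrite /map_overlap /= -map_comp.
  + by have := mor_row H Ht; rewrite -map_comp.
  + by have := mor_row H Hs; rewrite -map_comp.
Qed.

Definition gray_lift : mergemor (gray X Y) M :=
  quot_lift (gray_par (Y:=Y)) gray_lift_eq.

Lemma gray_lift_gen u : mor2 gray_lift (gray_cell2 u) = gray_lift2 u.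
Proof. by apply: etrans (quot_liftE (gray_par (Y:=Y)) gray_lift_eq (@gen (gray_poly X Y) u)) _. Qed.

End GrayLift.

Section GrayMapOn.
Variables (X X' Y Y' : mergebicat) (f : mergemor X X') (g : mergemor Y Y').

Lemma gray_map_inl y : mergemor_comp (gray_map f g) (gray_inl X y) =
  mergemor_comp (gray_inl X' (mor0 g y)) f.
Proof. by apply: mergemor_ext => // p; apply: (gray_map_gen f g (G20 p y)). Qed.

Lemma gray_map_inr x : mergemor_comp (gray_map f g) (gray_inr Y x) =
  mergemor_comp (gray_inr Y' (mor0 f x)) g.
Proof. by apply: mergemor_ext => // p; apply: (gray_map_gen f g (G02 x p)). Qed.

Lemma gray_map_sq a b : mor2 (gray_map f g) (gray_sq a b) =
  gray_sq (mor1 f a) (mor1 g b).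
Proof. exact: (gray_map_gen f g (G11 a b)). Qed.

End GrayMapOn.

(** * The hexagon *)

Section Hexagon.
Variable M : mergebicat.

Lemma row2 (U V : cell2 M) D e G (h : fits (Overlap D [:: e] [::] [::] G) (out U) (inp V)) :
  row [:: U; V] (mg (Overlap D [:: e] [::] [::] G) U V).
Proof. by rewrite -(mgE h); apply: rowS; apply: row1. Qed.

Lemma col2 (U V : cell2 M) D e G (h : fits (Overlap [::] [:: e] D G [::]) (out V) (inp U)) :
  col [:: U; V] (mg (Overlap [::] [:: e] D G [::]) V U).
Proof. by rewrite -(mgE h); apply: colS; apply: col1. Qed.

Variables (a1 a2 a3 b1 b2 c1 c2 d1 d2 e1 e2 f : cell1 M) (U V W P Q N : cell2 M).
Hypothesis U_bdry : inp U = [:: a1; a2] /\ out U = [:: b1; b2].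
Hypothesis V_bdry : inp V = [:: b2; a3] /\ out V = [:: c1; c2].
Hypothesis W_bdry : inp W = [:: b1; c1] /\ out W = [:: d1; d2].
Hypothesis P_bdry : inp P = [:: a2; a3] /\ out P = [:: e1; e2].
Hypothesis Q_bdry : inp Q = [:: a1; e1] /\ out Q = [:: d1; f].
Hypothesis N_bdry : inp N = [:: f; e2] /\ out N = [:: d2; c2].

Lemma hexagon_fits :
  [/\ fits (Overlap [:: b1] [:: b2] [::] [::] [:: a3]) (out U) (inp V),
      fits (Overlap [::] [:: c1] [:: c2] [:: b1] [::]) (out V) (inp W),
      fits (Overlap [::] [:: e1] [:: e2] [:: a1] [::]) (out P) (inp Q) &
      fits (Overlap [:: d1] [:: f] [::] [::] [:: e2]) (out Q) (inp N)].
Proof.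
case: U_bdry V_bdry W_bdry P_bdry Q_bdry N_bdry.
move=> _ -> [-> ->] [-> _] [_ ->] [-> ->] [-> _].
by split; split=> //=; auto.
Qed.

Lemma hexagon_fits2 :
  [/\ fits (Overlap [::] [:: e1; e2] [::] [:: a1] [::]) (out P)
        (inp (mg (Overlap [:: d1] [:: f] [::] [::] [:: e2]) Q N)),
      fits (Overlap [::] [:: b1; c1] [:: c2] [::] [::])
        (out (mg (Overlap [:: b1] [:: b2] [::] [::] [:: a3]) U V)) (inp W),
      fits (Overlap [::] [:: b1; b2] [::] [::] [:: a3]) (out U)
        (inp (mg (Overlap [::] [:: c1] [:: c2] [:: b1] [::]) V W)) &
      fits (Overlap [:: d1] [:: f; e2] [::] [::] [::])
        (out (mg (Overlap [::] [:: e1] [:: e2] [:: a1] [::]) P Q)) (inp N)].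
Proof.
have [fUV fVW fPQ fQN] := hexagon_fits.
rewrite !inp_mg // !out_mg //= U_bdry.2 V_bdry.1 V_bdry.2 W_bdry.1.
rewrite P_bdry.2 Q_bdry.1 Q_bdry.2 N_bdry.1.
by split; split=> //=; auto.
Qed.

(** The two halves of a cube.  The front consists of [U], [V], [W], the back of
    [P], [Q], [N].  On the left of the equivalence, the composites [Q N] and
    [U V] are rows through which [P] becomes [W]; on the right, [V W] and [P Q]
    are columns through which [U] becomes [N]. *)
Lemma hexagonE :
  mg (Overlap [::] [:: e1; e2] [::] [:: a1] [::]) P
    (mg (Overlap [:: d1] [:: f] [::] [::] [:: e2]) Q N) =
  mg (Overlap [::] [:: b1; c1] [:: c2] [::] [::])
    (mg (Overlap [:: b1] [:: b2] [::] [::] [:: a3]) U V) W <->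
  mg (Overlap [::] [:: b1; b2] [::] [::] [:: a3]) U
    (mg (Overlap [::] [:: c1] [:: c2] [:: b1] [::]) V W) =
  mg (Overlap [:: d1] [:: f; e2] [::] [::] [::])
    (mg (Overlap [::] [:: e1] [:: e2] [:: a1] [::]) P Q) N.
Proof.
have [fUV fVW fPQ fQN] := hexagon_fits.
have := @mg_assoc _ U V W [::] [:: b1] [:: b2] [::] [::] [::] [:: a3]
  [::] [:: c1] [:: c2] [::] [::].
have := @mg_assoc _ P Q N [::] [::] [:: e1] [:: e2] [::] [:: a1] [::]
  [:: d1] [:: f] [::] [::] [::].
by move=> /= -> //; [move=> -> //; [|left|left] | left | left]; split=> ->.
Qed.

End Hexagon.

(** * The associator *)

Section Associator.
Variables A B D : mergebicat.
Local Notation AB := (gray A B).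
Local Notation BD := (gray B D).

(** The associator has to commute with the inclusions of the three factors and
    to carry squares to squares, which leaves no choice for these families, nor for
    those of its inverse. *)
Definition assoc_L (z : cell0 D) : mergemor AB (gray A BD) :=
  gray_map (mergemor_id A) (gray_inl B z).

Definition assoc_R (u : cell0 AB) : mergemor D (gray A BD) :=
  mergemor_comp (gray_inr BD u.1) (gray_inr D u.2).

Definition assoc_S (u : cell1 AB) (d : cell1 D) : cell2 (gray A BD) :=
  match u with
  | G01 x b => mor2 (gray_inr BD x) (gray_sq b d)
  | G10 a y => @gray_sq A BD a (G01 y d)
  end.

Definition unassoc_L (v : cell0 BD) : mergemor A (gray AB D) :=
  mergemor_comp (gray_inl AB v.2) (gray_inl A v.1).

Definition unassoc_R (x : cell0 A) : mergemor BD (gray AB D) :=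
  gray_map (gray_inr B x) (mergemor_id D).

Definition unassoc_S (a : cell1 A) (v : cell1 BD) : cell2 (gray AB D) :=
  match v with
  | G01 y d => @gray_sq AB D (G10 a y) d
  | G10 b z => mor2 (gray_inl AB z) (gray_sq a b)
  end.

Lemma assoc_S_inp u d :
  inp (assoc_S u d) = [:: mor1 (assoc_R (src u)) d; mor1 (assoc_L (tgt d)) u].
Proof. by case: u => [x b|a y]; rewrite ?mor_inp gray_sq_inp. Qed.

Lemma assoc_S_out u d :
  out (assoc_S u d) = [:: mor1 (assoc_L (src d)) u; mor1 (assoc_R (tgt u)) d].
Proof. by case: u => [x b|a y]; rewrite ?mor_out gray_sq_out. Qed.

Lemma unassoc_S_inp a v : inp (unassoc_S a v) =
  [:: mor1 (unassoc_R (src a)) v; mor1 (unassoc_L (tgt v)) a].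
Proof. by case: v => [y d|b z]; rewrite ?mor_inp gray_sq_inp. Qed.

Lemma unassoc_S_out a v : out (unassoc_S a v) =
  [:: mor1 (unassoc_L (src v)) a; mor1 (unassoc_R (tgt a)) v].
Proof. by case: v => [y d|b z]; rewrite ?mor_out gray_sq_out. Qed.

(** The 1-cells of [gray A B] come from [B] or from [A].  In the former case
    naturality holds in [gray B D] and is carried to [gray A (gray B D)]; in the
    latter it is an instance of [gray_col_natural] there. *)
Lemma assoc_col c p : col_natural (assoc_R (src c)) (assoc_R (tgt c))
  (fun z => mor1 (assoc_L z) c) (assoc_S c) p.
Proof.
case: c => [x b|a y].
  exact: (@col_natural_image _ _ (gray_inr D (src b)) (gray_inr D (tgt b))
    (fun z => G10 b z) (gray_sq b) (gray_sq_inp b) (gray_sq_out b) _ (gray_inr BD x) _ (gray_col_natural b p)).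
exact: (@col_natural_comp _ _ _ _ _ _ _ (gray_inr D y) p).1 (gray_col_natural (Y := BD) a _).
Qed.

Lemma unassoc_row c p : row_natural (unassoc_L (src c)) (unassoc_L (tgt c))
  (fun x => mor1 (unassoc_R x) c) (fun a => unassoc_S a c) p.
Proof.
case: c => [y d|b z].
  exact: (@row_natural_comp _ _ _ _ _ _ _ (gray_inl A y) p).1 (gray_row_natural (X := AB) d _).
exact: (@row_natural_image _ _ (gray_inl A (src b)) (gray_inl A (tgt b))
  (fun x => G01 x b) (fun a => gray_sq a b) (fun a => gray_sq_inp a b)
  (fun a => gray_sq_out a b) _ (gray_inl AB z) _ (gray_row_natural b p)).
Qed.

(** Naturality of the row in the square of [a] and [b] is the cube equation of
    [a], [b] and [d], read along [a] as an instance of [gray_eq2]. *)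
Lemma assoc_row_sq (d : cell1 D) (a : cell1 A) (b : cell1 B) :
  row_natural (assoc_L (src d)) (assoc_L (tgt d))
    (fun u => mor1 (assoc_R u) d) (fun u => assoc_S u d) (gray_sq a b).
Proof.
move=> u u' t s h h'; rewrite (mgE h) (mgE h') {h h'}.
rewrite gray_sq_inp gray_sq_out /assoc_L !gray_map_sq => -[/= eu [_ eu']] Ht Hs.
subst u u'.
have bU := mor_sq_bdry (gray_inr BD (src a)) b d.
have bV := @gray_sq_bdry A BD a (G01 (tgt b) d).
have bW := @gray_sq_bdry A BD a (G10 b (src d)).
have bP := @gray_sq_bdry A BD a (G10 b (tgt d)).
have bQ := @gray_sq_bdry A BD a (G01 (src b) d).
have bN := mor_sq_bdry (gray_inr BD (tgt a)) b d.
have [fUV fVW fPQ fQN] := hexagon_fits bU bV bW bP bQ bN.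
have [_ _ k k'] := hexagon_fits2 bU bV bW bP bQ bN.
rewrite (row_uniq (M := gray A BD) Ht (row2 fQN)).
rewrite (row_uniq (M := gray A BD) Hs (row2 fUV)).
apply/(hexagonE bU bV bW bP bQ bN); rewrite -(mgE k) -(mgE k').
apply: (col_naturalE (gray_col_natural (Y := BD) a (gray_sq b d))
  (x := (src b, src d)) (x' := (tgt b, tgt d))); rewrite ?gray_sq_inp ?gray_sq_out //.
- exact: (col2 fVW).
- exact: (col2 fPQ).
Qed.

(** The same cube, read along [d] as an instance of [gray_eq3]. *)
Lemma unassoc_col_sq (a : cell1 A) (b : cell1 B) (d : cell1 D) :
  col_natural (unassoc_R (src a)) (unassoc_R (tgt a))
    (fun v => mor1 (unassoc_L v) a) (unassoc_S a) (gray_sq b d).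
Proof.
move=> u u' t s h h'; rewrite (mgE h) (mgE h') {h h'}.
rewrite gray_sq_inp gray_sq_out /unassoc_R !gray_map_sq => -[/= eu [_ eu']] Ht Hs.
subst u u'.
have bU := @gray_sq_bdry AB D (G01 (src a) b) d.
have bV := @gray_sq_bdry AB D (G10 a (tgt b)) d.
have bW := mor_sq_bdry (gray_inl AB (src d)) a b.
have bP := mor_sq_bdry (gray_inl AB (tgt d)) a b.
have bQ := @gray_sq_bdry AB D (G10 a (src b)) d.
have bN := @gray_sq_bdry AB D (G01 (tgt a) b) d.
have [fUV fVW fPQ fQN] := hexagon_fits bU bV bW bP bQ bN.
have [k k' _ _] := hexagon_fits2 bU bV bW bP bQ bN.
rewrite (col_uniq (M := gray AB D) Ht (col2 fVW)).
rewrite (col_uniq (M := gray AB D) Hs (col2 fPQ)).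
apply/(hexagonE bU bV bW bP bQ bN); rewrite -(mgE k) -(mgE k').
apply: (row_naturalE (gray_row_natural (X := AB) d (gray_sq a b))
  (x := (src a, src b)) (x' := (tgt a, tgt b))); rewrite ?gray_sq_inp ?gray_sq_out //.
- exact: (row2 fQN).
- exact: (row2 fUV).
Qed.

(** The generators coming from [B] and from [A] are covered by
    [gray_row_natural], in [gray B D] and in [gray A (gray B D)] respectively. *)
Lemma assoc_row c p : row_natural (assoc_L (src c)) (assoc_L (tgt c))
  (fun u => mor1 (assoc_R u) c) (fun u => assoc_S u c) p.
Proof.
elim/gray_ind: p => [[x q|p y|a b]|t s w h Ht Hs].
- apply: (@row_natural_comp _ _ _ _ _ _ _ (gray_inr B x) q).2.
  rewrite /assoc_L !gray_map_inr.
  exact: (@row_natural_image _ _ (gray_inl B (src c)) (gray_inl B (tgt c))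
    (fun x => G01 x c) (fun a => gray_sq a c) (fun a => gray_sq_inp a c)
  (fun a => gray_sq_out a c) _
    (gray_inr BD x) _ (gray_row_natural c q)).
- apply: (@row_natural_comp _ _ _ _ _ _ _ (gray_inl A y) p).2.
  rewrite /assoc_L !gray_map_inl.
  exact: (@gray_row_natural A BD (G01 y c) p).
- exact: assoc_row_sq.
- apply: row_natural_mrg => // u; [exact: assoc_S_inp | exact: assoc_S_out].
Qed.

Lemma unassoc_col c p : col_natural (unassoc_R (src c)) (unassoc_R (tgt c))
  (fun v => mor1 (unassoc_L v) c) (unassoc_S c) p.
Proof.
elim/gray_ind: p => [[y q|q z|b d]|t s w h Ht Hs].
- apply: (@col_natural_comp _ _ _ _ _ _ _ (gray_inr D y) q).2.
  rewrite /unassoc_R !gray_map_inr.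
  exact: (@gray_col_natural AB D (G10 c y) q).
- apply: (@col_natural_comp _ _ _ _ _ _ _ (gray_inl B z) q).2.
  rewrite /unassoc_R !gray_map_inl.
  exact: (@col_natural_image _ _ (gray_inr B (src c)) (gray_inr B (tgt c))
    (fun z => G10 c z) (gray_sq c) (gray_sq_inp c) (gray_sq_out c) _
    (gray_inl AB z) _ (gray_col_natural c q)).
- exact: unassoc_col_sq.
- apply: col_natural_mrg => // u; [exact: unassoc_S_inp | exact: unassoc_S_out].
Qed.

Definition assoc : mergemor (gray AB D) (gray A BD) :=
  @gray_lift AB D (gray A BD) assoc_L assoc_R assoc_S (fun _ _ => erefl)
    assoc_S_inp assoc_S_out assoc_row assoc_col.

Definition unassoc : mergemor (gray A BD) (gray AB D) :=
  @gray_lift A BD (gray AB D) unassoc_L unassoc_R unassoc_S (fun _ _ => erefl)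
    unassoc_S_inp unassoc_S_out unassoc_row unassoc_col.

End Associator.

(** * The monoidal structure *)

Section Computation.
Variables (X Y X' Y' A B D : mergebicat).

Lemma compE (M N P : premerge) (g : mergemor N P) (f : mergemor M N) p :
  mor2 (mergemor_comp g f) p = mor2 g (mor2 f p).
Proof. by []. Qed.

Lemma idE (M : premerge) p : mor2 (mergemor_id M) p = p.
Proof. by []. Qed.

Lemma map_inlE (f : mergemor X X') (g : mergemor Y Y') y p :
  mor2 (gray_map f g) (mor2 (gray_inl X y) p) =
  mor2 (gray_inl X' (mor0 g y)) (mor2 f p).
Proof. exact: (gray_map_gen f g (G20 p y)). Qed.

Lemma map_inrE (f : mergemor X X') (g : mergemor Y Y') x p :
  mor2 (gray_map f g) (mor2 (gray_inr Y x) p) =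
  mor2 (gray_inr Y' (mor0 f x)) (mor2 g p).
Proof. exact: (gray_map_gen f g (G02 x p)). Qed.

Lemma assoc_inlE z p : mor2 (assoc A B D) (mor2 (gray_inl _ z) p) =
  mor2 (gray_map (mergemor_id A) (gray_inl B z)) p.
Proof. exact: (gray_lift_gen _ _ _ _ _ (G20 p z)). Qed.

Lemma assoc_inrE u p : mor2 (assoc A B D) (mor2 (gray_inr _ u) p) =
  mor2 (gray_inr _ u.1) (mor2 (gray_inr _ u.2) p).
Proof. exact: (gray_lift_gen _ _ _ _ _ (G02 u p)). Qed.

Lemma assoc_sq01E x b d : mor2 (assoc A B D) (@gray_sq (gray A B) D (G01 x b) d) =
  mor2 (gray_inr _ x) (gray_sq b d).
Proof. exact: (gray_lift_gen _ _ _ _ _ (G11 _ d)). Qed.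

Lemma assoc_sq10E a y d : mor2 (assoc A B D) (@gray_sq (gray A B) D (G10 a y) d) =
  @gray_sq A (gray B D) a (G01 y d).
Proof. exact: (gray_lift_gen _ _ _ _ _ (G11 _ d)). Qed.

Lemma unassoc_inlE v p : mor2 (unassoc A B D) (mor2 (gray_inl _ v) p) =
  mor2 (gray_inl _ v.2) (mor2 (gray_inl _ v.1) p).
Proof. exact: (gray_lift_gen _ _ _ _ _ (G20 p v)). Qed.

Lemma unassoc_inrE x p : mor2 (unassoc A B D) (mor2 (gray_inr _ x) p) =
  mor2 (gray_map (gray_inr B x) (mergemor_id D)) p.
Proof. exact: (gray_lift_gen _ _ _ _ _ (G02 x p)). Qed.

Lemma unassoc_sq01E a y d : mor2 (unassoc A B D) (@gray_sq A (gray B D) a (G01 y d)) =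
  @gray_sq (gray A B) D (G10 a y) d.
Proof. exact: (gray_lift_gen _ _ _ _ _ (G11 a _)). Qed.

Lemma unassoc_sq10E a b z : mor2 (unassoc A B D) (@gray_sq A (gray B D) a (G10 b z)) =
  mor2 (gray_inl _ z) (gray_sq a b).
Proof. exact: (gray_lift_gen _ _ _ _ _ (G11 a _)). Qed.

End Computation.

Definition grayE := (compE, idE, map_inlE, map_inrE, gray_map_sq,
  assoc_inlE, assoc_inrE, assoc_sq01E, assoc_sq10E,
  unassoc_inlE, unassoc_inrE, unassoc_sq01E, unassoc_sq10E).

Lemma gray_map_id (A B : mergebicat) :
  gray_map (mergemor_id A) (mergemor_id B) = mergemor_id (gray A B).
Proof.
by apply: gray_hom_ext => [y|x|a b]; [apply: mergemor_ext => // p ..|];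
  rewrite !grayE.
Qed.

Lemma gray_map_comp (A A' A'' B B' B'' : mergebicat) (f' : mergemor A' A'')
    (f : mergemor A A') (g' : mergemor B' B'') (g : mergemor B B') :
  gray_map (mergemor_comp f' f) (mergemor_comp g' g) =
  mergemor_comp (gray_map f' g') (gray_map f g).
Proof.
by apply: gray_hom_ext => [y|x|a b]; [apply: mergemor_ext => // p ..|];
  rewrite !grayE.
Qed.

Lemma assocK (A B D : mergebicat) :
  mergemor_comp (unassoc A B D) (assoc A B D) = mergemor_id _.
Proof.
apply: gray_hom_ext => [z|u|[x b|a y] d]; rewrite ?grayE //.
  apply: gray_hom_ext => [y|x|a b]; rewrite ?grayE //.
  - by apply: mergemor_ext => // p; rewrite !grayE.
  - by apply: mergemor_ext => // p; rewrite !grayE.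
by case: u => x y; apply: mergemor_ext => // p; rewrite !grayE.
Qed.

Lemma unassocK (A B D : mergebicat) :
  mergemor_comp (assoc A B D) (unassoc A B D) = mergemor_id _.
Proof.
apply: gray_hom_ext => [v|x|a [y d|b z]]; rewrite ?grayE //.
  by case: v => y z; apply: mergemor_ext => // p; rewrite !grayE.
apply: gray_hom_ext => [z|y|b d]; rewrite ?grayE //.
- by apply: mergemor_ext => // p; rewrite !grayE.
- by apply: mergemor_ext => // p; rewrite !grayE.
Qed.

Lemma assoc_nat (A A' B B' D D' : mergebicat) (f : mergemor A A')
    (g : mergemor B B') (h : mergemor D D') :
  mergemor_comp (assoc A' B' D') (gray_map (gray_map f g) h) =
  mergemor_comp (gray_map f (gray_map g h)) (assoc A B D).
Proof.
apply: gray_hom_ext => [z|u|[x b|a y] d]; rewrite ?grayE //.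
  apply: gray_hom_ext => [y|x|a b]; rewrite ?grayE //.
  - by apply: mergemor_ext => // p; rewrite !grayE.
  - by apply: mergemor_ext => // p; rewrite !grayE.
by case: u => x y; apply: mergemor_ext => // p; rewrite !grayE.
Qed.

Section Unitors.
Local Notation I := merge_one.

Definition from_one (M : mergebicat) (x : cell0 M) : mergemor I M.
Proof.
unshelve refine (@MergeMor I M (@PolyMor I M (fun=> x)
  (fun a : Empty_set => match a with end) (fun a : Empty_set => match a with end)
  _ _ _ _) _).
all: by case.
Defined.

Variable A : mergebicat.

Definition lunit : mergemor (gray I A) A.
Proof.
apply: (@gray_lift I A A (@from_one A) (fun=> mergemor_id A)
  (fun a : Empty_set => match a with end)) => //; by case.
Defined.

Definition runit : mergemor (gray A I) A.
Proof.
apply: (@gray_lift A I A (fun=> mergemor_id A) (@from_one A)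
  (fun _ (a : Empty_set) => match a with end)).
- by [].
- by move=> a [].
- by move=> a [].
- by case.
- by move=> c [].
Defined.

Lemma lunit_inrE x p : mor2 lunit (mor2 (gray_inr A x) p) = p.
Proof. exact: (gray_lift_gen _ _ _ _ _ (G02 x p)). Qed.

Lemma runit_inlE x p : mor2 runit (mor2 (gray_inl A x) p) = p.
Proof. exact: (gray_lift_gen _ _ _ _ _ (G20 p x)). Qed.

Lemma lunit_inr : mergemor_comp lunit (@gray_inr merge_one A tt) = mergemor_id A.
Proof. by apply: mergemor_ext => // p; rewrite !grayE lunit_inrE. Qed.

Lemma runit_inl : mergemor_comp runit (@gray_inl A merge_one tt) = mergemor_id A.
Proof. by apply: mergemor_ext => // p; rewrite !grayE runit_inlE. Qed.

Lemma lunitK : mergemor_comp (@gray_inr merge_one A tt) lunit = mergemor_id _.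
Proof.
apply: gray_hom_ext => [y|[]|[]].
  by apply: mergemor_ext => -[].
by apply: mergemor_ext => // p; rewrite !grayE lunit_inrE.
Qed.

Lemma runitK : mergemor_comp (@gray_inl A merge_one tt) runit = mergemor_id _.
Proof.
apply: gray_hom_ext => [[]|x|? []].
  by apply: mergemor_ext => // p; rewrite !grayE runit_inlE.
by apply: mergemor_ext => -[].
Qed.

End Unitors.

Lemma lunit_nat (A A' : mergebicat) (f : mergemor A A') :
  mergemor_comp (lunit A') (gray_map (mergemor_id _) f) = mergemor_comp f (lunit A).
Proof.
apply: gray_hom_ext => [y|x|[]]; first by apply: mergemor_ext => -[].
by apply: mergemor_ext => // p; rewrite !grayE !lunit_inrE.
Qed.

Lemma runit_nat (A A' : mergebicat) (f : mergemor A A') :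
  mergemor_comp (runit A') (gray_map f (mergemor_id _)) = mergemor_comp f (runit A).
Proof.
apply: gray_hom_ext => [y|x|? []]; last by apply: mergemor_ext => -[].
by apply: mergemor_ext => // p; rewrite !grayE !runit_inlE.
Qed.

Lemma gray_triangle (A B : mergebicat) :
  mergemor_comp (gray_map (mergemor_id A) (lunit B)) (assoc A merge_one B) =
  gray_map (runit A) (mergemor_id B).
Proof.
apply: gray_hom_ext => [z|[x []]|[x []|a y] d].
- apply: gray_hom_ext => [y|x|a []]; last by apply: mergemor_ext => -[].
  by apply: mergemor_ext => // p; rewrite !grayE runit_inlE.
- by apply: mergemor_ext => // p; rewrite !grayE lunit_inrE.
- by rewrite !grayE.
Qed.

Lemma gray_pentagon (A B D E : mergebicat) :
  mergemor_comp (assoc A B (gray D E)) (assoc (gray A B) D E) =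
  mergemor_comp (gray_map (mergemor_id A) (assoc B D E))
    (mergemor_comp (assoc A (gray B D) E)
       (gray_map (assoc A B D) (mergemor_id E))).
Proof.
apply: gray_hom_ext => [w|u|[u d|[x b|a y] z] e].
- apply: gray_hom_ext => [z|u|[x b|a y] d]; rewrite ?grayE //.
  + apply: gray_hom_ext => [y|x|a b]; rewrite ?grayE //.
    * by apply: mergemor_ext => // p; rewrite !grayE.
    * by apply: mergemor_ext => // p; rewrite !grayE.
  + by case: u => x y; apply: mergemor_ext => // p; rewrite !grayE.
- by case: u => [[x y] z]; apply: mergemor_ext => // p; rewrite !grayE.
- by case: u => x y; rewrite !grayE.
- by rewrite !grayE.
- by rewrite !grayE.
Qed.

Theorem proposition5p21 :
  inhabited (@monoidal_structure MrgBiCat gray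
    (fun X X' Y Y' f g => gray_map f g) merge_one).
Proof.
apply: inhabits.
exact: (@MonoidalStructure MrgBiCat gray (fun X X' Y Y' f g => gray_map f g) merge_one
  gray_map_id gray_map_comp assoc lunit runit
  (fun A B D => ex_intro _ (unassoc A B D) (conj (assocK A B D) (unassocK A B D)))
  (fun A => ex_intro _ (@gray_inr merge_one A tt) (conj (lunitK A) (lunit_inr A)))
  (fun A => ex_intro _ (@gray_inl A merge_one tt) (conj (runitK A) (runit_inl A)))
  assoc_nat lunit_nat runit_nat gray_triangle gray_pentagon).
Qed.
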